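(* Let $\mu_1$ and $\mu_2$ be Borel probability measures on the unit circle $\mathbb{T}$, neither of which is a point mass, and set $\mu=\mu_1\boxtimes\mu_2$. For a Borel probability measure $\nu$ on $\mathbb{T}$ and $t\in\mathbb{T}$ with $1/t\notin{\rm supp}(\nu)$, let \[V_\nu(t)=\left|\int_{\mathbb{T}}\frac{d\nu(s)}{(1-ts)^2}-\left[\int_{\mathbb{T}}\frac{d\nu(s)}{1-ts}\right]^2\right|,\] and let $C_\nu=\{t\in\mathbb{T}:1/t\notin{\rm supp}(\nu)\}$. Define \[D_{\mu_1,\mu_2}=\Big\{(t_1,t_2)\in C_{\mu_1}\times C_{\mu_2}:\psi_{\mu_1}(t_1)=\psi_{\mu_2}(t_2),\ \frac{V_{\mu_1}(t_1)V_{\mu_2}(t_2)}{|\psi_{\mu_1}(t_1)(\psi_{\mu_1}(t_1)+1)|^2}<1\Big\}.\] Then $t\mapsto(\omega_1(t),\omega_2(t))$ maps $C_\mu$ homeomorphically onto $D_{\mu_1,\mu_2}$, and the inverse map is \[(t_1,t_2)\mapsto\frac{t_1t_2}{\eta_{\mu_1}(t_1)}=\frac{t_1t_2}{\eta_{\mu_2}(t_2)}.\]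
   Context: $\mathbb{D}$ is the open unit disk and $\mathbb{T}$ the unit circle. For a Borel probability measure $\nu$ on $\mathbb{T}$, $\psi_\nu(z)=\int_{\mathbb{T}}\frac{zs}{1-zs}\,d\nu(s)$ and $\eta_\nu(z)=\psi_\nu(z)/(1+\psi_\nu(z))$ for $z\in\mathbb{D}$; both extend analytically to every $z\in\mathbb{T}$ with $1/z\notin{\rm supp}(\nu)$ (given by the same formulas). The free multiplicative convolution $\mu_1\boxtimes\mu_2$ is the distribution of $x_1x_2$ for $*$-free unitaries $x_1,x_2$ in a tracial $W^*$-probability space with distributions $\mu_1,\mu_2$. The subordination functions $\omega_1,\omega_2:\mathbb{D}\cup\mathbb{T}\to\mathbb{D}\cup\mathbb{T}$ are the unique continuous functions, analytic on $\mathbb{D}$ with $\omega_j(0)=0$, such that $\eta_\mu(z)=\eta_{\mu_1}(\omega_1(z))=\eta_{\mu_2}(\omega_2(z))=\omega_1(z)\omega_2(z)/z$ for $z\in\mathbb{D}$. *)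

(* Defs.v *)
From HB Require Import structures.
From mathcomp Require Import all_boot all_order all_algebra.
From mathcomp Require Import all_classical all_reals all_analysis.
From mathcomp Require Import complex.
Set Implicit Arguments.
Unset Strict Implicit.
Unset Printing Implicit Defensive.
Import Order.TTheory GRing.Theory Num.Theory.
Local Open Scope classical_set_scope.
Local Open Scope ring_scope.

Section FreeMult.
Variable R : realType.
Local Notation C := R[i].

Definition fm_cabs (z : C) : R := Num.sqrt (complex.Re z ^+ 2 + complex.Im z ^+ 2).

Definition fm_toC (p : R * R) : C := (p.1 +i* p.2)%C.
Definition fm_fromC (z : C) : R * R := (complex.Re z, complex.Im z).

Definition fm_Tset : set (R * R) := [set p | p.1 ^+ 2 + p.2 ^+ 2 = 1].

(* A Borel probability measure on T: a probability measure on the Borel sets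
   of R^2 (= product sigma-algebra) giving full mass to T. *)
Definition prob_on_T (nu : probability (R * R)%type R) : Prop :=
  nu fm_Tset = 1%E.

Definition is_point_mass (nu : probability (R * R)%type R) : Prop :=
  exists a : R * R, forall B, measurable B -> nu B = dirac a B.

Definition fm_cint (nu : probability (R * R)%type R) (f : R * R -> C) : C :=
  (fine (\int[nu]_x ((complex.Re (f x))%:E))
    +i* fine (\int[nu]_x ((complex.Im (f x))%:E)))%C.

Definition fm_eball (p : R * R) (e : R) : set (R * R) :=
  [set q | (q.1 - p.1) ^+ 2 + (q.2 - p.2) ^+ 2 < e ^+ 2].
Definition fm_supp (nu : probability (R * R)%type R) : set (R * R) :=
  [set p | forall e : R, 0 < e -> (0 < nu (fm_eball p e))%E].

Definition fm_psi (nu : probability (R * R)%type R) (z : C) : C :=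
  fm_cint nu (fun s => z * fm_toC s / (1 - z * fm_toC s)).
Definition fm_eta (nu : probability (R * R)%type R) (z : C) : C :=
  fm_psi nu z / (1 + fm_psi nu z).

Definition fm_Cset (nu : probability (R * R)%type R) : set C :=
  [set t | fm_cabs t = 1 /\ ~ fm_supp nu (fm_fromC t^-1)].

Definition fm_Vfun (nu : probability (R * R)%type R) (t : C) : R :=
  fm_cabs (fm_cint nu (fun s => 1 / (1 - t * fm_toC s) ^+ 2)
        - (fm_cint nu (fun s => 1 / (1 - t * fm_toC s))) ^+ 2).

Definition fm_Dset (mu1 mu2 : probability (R * R)%type R) : set (C * C) :=
  [set q | fm_Cset mu1 q.1 /\ fm_Cset mu2 q.2 /\ fm_psi mu1 q.1 = fm_psi mu2 q.2 /\
           fm_Vfun mu1 q.1 * fm_Vfun mu2 q.2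
             / fm_cabs (fm_psi mu1 q.1 * (fm_psi mu1 q.1 + 1)) ^+ 2 < 1].

(* the (unital) algebra generated by an invertible x : Laurent polynomials in x *)
Definition fm_in_laurent (A : unitAlgType C) (x a : A) : Prop :=
  exists s : seq (int * C), a = \sum_(p <- s) p.2 *: x ^ p.1.

Definition fm_free_pair (A : unitAlgType C) (phi : A -> C) (x1 x2 : A) : Prop :=
  forall (n : nat) (idx : nat -> bool) (a : nat -> A),
    (forall k, (k < n)%N -> idx k != idx k.+1) ->
    (forall k, (k <= n)%N ->
        fm_in_laurent (if idx k then x1 else x2) (a k) /\ phi (a k) = 0) ->
    phi (\prod_(0 <= k < n.+1) a k) = 0.

Definition fm_has_dist (A : unitAlgType C) (phi : A -> C) (x : A)
    (nu : probability (R * R)%type R) : Prop :=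
  forall n : int, phi (x ^ n) = fm_cint nu (fun s => fm_toC s ^ n).

(* mu = mu1 [x] mu2 : mu is the distribution of x1 x2 where x1, x2 are free
   invertible elements with distributions mu1, mu2 in a tracial (algebraic)
   noncommutative probability space (A, phi). *)
Definition free_mult_conv (mu1 mu2 mu : probability (R * R)%type R) : Prop :=
  exists (A : unitAlgType C) (phi : A -> C) (x1 x2 : A),
    [/\ (forall a b, phi (a + b) = phi a + phi b),
        (forall (c : C) a, phi (c *: a) = c * phi a),
        phi 1 = 1,
        (forall a b, phi (a * b) = phi (b * a)) &
        [/\ x1 \is a GRing.unit, x2 \is a GRing.unit,
            fm_free_pair phi x1 x2,
            fm_has_dist phi x1 mu1 &
            [/\ fm_has_dist phi x2 mu2 & fm_has_dist phi (x1 * x2) mu]]].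

Definition fm_cont_within (S : set C) (f : C -> C) (z : C) : Prop :=
  forall e : R, 0 < e -> exists2 d : R, 0 < d &
    forall w, S w -> fm_cabs (w - z) < d -> fm_cabs (f w - f z) < e.

Definition fm_holo_at (f : C -> C) (z : C) : Prop :=
  exists L : C, forall e : R, 0 < e -> exists2 d : R, 0 < d &
    forall w, 0 < fm_cabs (w - z) < d -> fm_cabs ((f w - f z) / (w - z) - L) < e.

Definition fm_cdisk : set C := [set z | fm_cabs z <= 1].

(* w1, w2 are the subordination functions of mu = mu1 [x] mu2:
   continuous maps D u T -> D u T, analytic on D, vanishing at 0, with
   eta_mu(z) = eta_mu1(w1 z) = eta_mu2(w2 z) = w1(z) w2(z) / z on D
   (at z = 0 all three expressions are 0 with the convention x / 0 = 0). *)
Definition subordination (mu1 mu2 mu : probability (R * R)%type R)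
    (w1 w2 : C -> C) : Prop :=
  (forall w, w = w1 \/ w = w2 ->
     [/\ (forall z, fm_cabs z <= 1 -> fm_cabs (w z) <= 1),
         (forall z, fm_cabs z <= 1 -> fm_cont_within fm_cdisk w z),
         (forall z, fm_cabs z < 1 -> fm_holo_at w z) &
         w 0 = 0]) /\
  (forall z, fm_cabs z < 1 ->
     [/\ fm_eta mu z = fm_eta mu1 (w1 z),
         fm_eta mu z = fm_eta mu2 (w2 z) &
         fm_eta mu z = w1 z * w2 z / z]).

Definition fm_cont2_within (S : set (C * C)) (g : C * C -> C) (q : C * C) : Prop :=
  forall e : R, 0 < e -> exists2 d : R, 0 < d &
    forall q', S q' -> fm_cabs (q'.1 - q.1) < d -> fm_cabs (q'.2 - q.2) < d ->
      fm_cabs (g q' - g q) < e.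

End FreeMult.

(* Main.v *)
Require Import Defs.
From HB Require Import structures.
From mathcomp Require Import all_boot all_order all_algebra.
From mathcomp Require Import all_classical all_reals all_analysis.
From mathcomp Require Import measurable_realfun complex.
From mathcomp Require Import ring lra.
Set Implicit Arguments.
Unset Strict Implicit.
Unset Printing Implicit Defensive.
Import Order.TTheory GRing.Theory Num.Theory.
Import numFieldNormedType.Exports.
Local Open Scope classical_set_scope.
Local Open Scope ring_scope.

(* For a measure nu on the circle put X_z(s) = 1 / (1 - z s) and h(z) = eta(z) / z. Since |s| = 1,
   the kernel (1 - h(z) h(w)^conj) / (1 - z w^conj) is the covariance of s X_z and s X_w divided by
   E X_z (E X_w)^conj, so Cauchy-Schwarz replaces the Schwarz-Pick and Julia lemmas. Its diagonal k
   is V / |psi (psi + 1)| on the circle. The subordination functions solve w1 = z h2(w2) and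
   w2 = z h1(w1).

   For t in C_mu, the integral of |X_w1(z)|^2 against mu1 stays bounded for z near t, and w1 is
   injective and unimodular on an arc around t; hence w1 maps this arc onto a neighbourhood of w1(t),
   every small ball around a point of its inverse has mu1-mass quadratic in the radius, and
   w1(t) lies in C_mu1. Comparing 1 - |w1|^2 and 1 - |w2|^2 with 1 - |z|^2 gives k1 k2 < 1.

   Conversely, if (t1, t2) is in D and u = t1 t2 / eta_mu1(t1), then t1 = u h2(t2), t2 = u h1(t1), and
   Julia's inequality with k1 k2 < 1 forces w1(r u) -> t1 and w2(r u) -> t2 as r -> 1, provided
   eta_mu(r u) does not vanish. Near u the same comparison of defects bounds the integral of |X_z|^2
   against mu, so u lies in C_mu. *)

(** The predicate [regular] asks that 1 / (1 - z s) be essentially bounded. It holds both in the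
    disk and on [fm_Cset], so one set of kernel identities serves interior and boundary points
    alike. A bound on the second moment of X_z near one boundary point says nothing about the
    support. Near every point of an arc it does: N pieces of length l / N have mass O(1 / N^2) each,
    so the arc has mass O(1 / N), hence zero. This is why w1 must be shown to cover a whole arc
    around w1(t), and injectivity with the intermediate value theorem provides that. The strict
    inequality k1 k2 < 1 must survive a passage to the boundary, so it has to be proved in the disk
    with a margin independent of z. The fixed-point equations are available only where eta_mu is
    nonzero. If eta_mu vanishes on a piece of a radius, Taylor expansions carry the vanishing to the
    origin, where the coefficients are the moments of mu. *)

(** * Modulus, conjugation, real and imaginary parts *)

Section ComplexModulus.
Variable R : realType.
Local Notation C := R[i].
Local Notation cabs := (@fm_cabs R).
Implicit Types z w : C.

Lemma cabs_normc z : cabs z = ComplexField.Normc.normc z.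
Proof. by case: z. Qed.

Lemma cabsM z w : cabs (z * w) = cabs z * cabs w.
Proof. by rewrite !cabs_normc ComplexField.Normc.normcM. Qed.

Lemma cabsV z : cabs z^-1 = (cabs z)^-1.
Proof. by rewrite !cabs_normc ComplexField.Normc.normcV. Qed.

Lemma cabs_div z w : cabs (z / w) = cabs z / cabs w.
Proof. by rewrite cabsM cabsV. Qed.

Lemma cabsD z w : cabs (z + w) <= cabs z + cabs w.
Proof. by rewrite !cabs_normc le_normcD. Qed.

Lemma cabsN z : cabs (- z) = cabs z.
Proof. by rewrite !cabs_normc normcN. Qed.

Lemma cabsB z w : cabs (z - w) <= cabs z + cabs w.
Proof. by rewrite -(cabsN w) cabsD. Qed.

Lemma cabs_distC z w : cabs (z - w) = cabs (w - z).
Proof. by rewrite -cabsN opprB. Qed.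

Lemma cabs_dist_triangle z u w : cabs (z - w) <= cabs (z - u) + cabs (u - w).
Proof. by have := cabsD (z - u) (u - w); rewrite addrA subrK. Qed.

Lemma cabs_ge_sub z w : cabs z - cabs w <= cabs (z - w).
Proof. by rewrite lerBlDr; have := cabsD (z - w) w; rewrite subrK. Qed.

Lemma cabs_ge0 z : 0 <= cabs z.
Proof. exact: sqrtr_ge0. Qed.

Lemma cabs0 : cabs 0 = 0.
Proof. by rewrite cabs_normc ComplexField.Normc.normc0. Qed.

Lemma cabs1 : cabs 1 = 1.
Proof. by rewrite cabs_normc ComplexField.Normc.normc1. Qed.

Lemma cabs_eq0 z : (cabs z == 0) = (z == 0).
Proof.
apply/eqP/eqP => [|->]; last exact: cabs0.
by rewrite cabs_normc => /ComplexField.Normc.eq0_normc.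
Qed.

Lemma cabs_gt0 z : (0 < cabs z) = (z != 0).
Proof. by rewrite lt_neqAle cabs_ge0 andbT eq_sym cabs_eq0. Qed.

Lemma cabsX z n : cabs (z ^+ n) = cabs z ^+ n.
Proof. by elim: n => [|n ih]; rewrite ?expr0 ?cabs1 // !exprS cabsM ih. Qed.

Lemma cabs_sqr z : cabs z ^+ 2 = complex.Re z ^+ 2 + complex.Im z ^+ 2.
Proof. by rewrite sqr_sqrtr // addr_ge0 // sqr_ge0. Qed.

Lemma cabs_conj z : cabs z^*%C = cabs z.
Proof. by case: z => x y; rewrite /fm_cabs /= sqrrN. Qed.

Lemma mul_conjc z : z * z^*%C = (cabs z ^+ 2)%:C%C.
Proof.
rewrite cabs_sqr; case: z => x y /=.
by apply/eqP; rewrite eq_complex /=; apply/andP; split; apply/eqP; ring.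
Qed.

Lemma cabs_real (x : R) : cabs x%:C%C = `|x|.
Proof. by rewrite /fm_cabs /= expr0n addr0 sqrtr_sqr. Qed.

Lemma cabs_realM (x : R) z : 0 <= x -> cabs (x%:C%C * z) = x * cabs z.
Proof. by move=> x0; rewrite cabsM cabs_real ger0_norm. Qed.

Lemma normr_Re_le z : `|complex.Re z| <= cabs z.
Proof.
by rewrite -ler_sqr ?nnegrE ?cabs_ge0 // cabs_sqr real_normK ?num_real // lerDl sqr_ge0.
Qed.

Lemma normr_Im_le z : `|complex.Im z| <= cabs z.
Proof.
by rewrite -ler_sqr ?nnegrE ?cabs_ge0 // cabs_sqr real_normK ?num_real // lerDr sqr_ge0.
Qed.

Lemma Re_le_cabs z : complex.Re z <= cabs z.
Proof. exact: le_trans (ler_norm _) (normr_Re_le z). Qed.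

Lemma cabs_le_ReIm z : cabs z <= `|complex.Re z| + `|complex.Im z|.
Proof.
rewrite -ler_sqr ?nnegrE ?cabs_ge0 ?addr_ge0 // cabs_sqr.
rewrite -(real_normK (num_real (complex.Re z))) -(real_normK (num_real (complex.Im z))).
by have := normr_ge0 (complex.Re z); have := normr_ge0 (complex.Im z); nra.
Qed.

Lemma cReD z w : complex.Re (z + w) = complex.Re z + complex.Re w.
Proof. by case: z w => ? ? []. Qed.
Lemma cImD z w : complex.Im (z + w) = complex.Im z + complex.Im w.
Proof. by case: z w => ? ? []. Qed.
Lemma cReN z : complex.Re (- z) = - complex.Re z.
Proof. by case: z. Qed.
Lemma cImN z : complex.Im (- z) = - complex.Im z.
Proof. by case: z. Qed.
Lemma cReM z w : complex.Re (z * w) =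
  complex.Re z * complex.Re w - complex.Im z * complex.Im w.
Proof. by case: z w => ? ? []. Qed.
Lemma cImM z w : complex.Im (z * w) =
  complex.Re z * complex.Im w + complex.Im z * complex.Re w.
Proof. by case: z w => ? ? []. Qed.

Lemma complex_eq z w : complex.Re z = complex.Re w ->
  complex.Im z = complex.Im w -> z = w.
Proof. by case: z w => ? ? [? ?] /= -> ->. Qed.

Lemma conjcM z w : (z * w)^*%C = z^*%C * w^*%C.
Proof. exact: rmorphM. Qed.
Lemma conjcD z w : (z + w)^*%C = z^*%C + w^*%C.
Proof. exact: rmorphD. Qed.
Lemma conjcN z : (- z)^*%C = - z^*%C.
Proof. exact: rmorphN. Qed.

Lemma conjc_unit z : cabs z = 1 -> z^*%C = z^-1.
Proof.
move=> z1; have z0 : z != 0 by rewrite -cabs_gt0 z1.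
by apply: (mulfI z0); rewrite mul_conjc z1 expr1n mulfV.
Qed.

Lemma cabs1_neq0 z : cabs z = 1 -> z != 0.
Proof. by move=> z1; rewrite -cabs_gt0 z1. Qed.

Lemma cabs_one_sub_conj z w : cabs w = 1 -> cabs (1 - z * w^*%C) = cabs (z - w).
Proof.
move=> w1; have w0 := cabs1_neq0 w1.
rewrite (_ : 1 - z * w^*%C = (w - z) / w); last by rewrite conjc_unit // mulrBl divff.
by rewrite cabs_div w1 divr1 cabs_distC.
Qed.

End ComplexModulus.

(** * Integration of essentially bounded functions *)

Section BoundedFunctions.
Variables (R : realType) (nu : probability (R * R)%type R).
Local Notation C := R[i].
Local Notation cabs := (@fm_cabs R).
Implicit Types (u v : R * R -> R) (f g : R * R -> C).

(** Essential rather than plain boundedness: at a circle point z the resolvent is controlled only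
    off a null set, made of the complement of the circle and a ball around 1/z. The class is closed
    under sums and products, so integrability is automatic throughout. *)
Definition ess_bounded u : Prop :=
  measurable_fun setT u /\ exists M : R, {ae nu, forall s, `|u s| <= M}.

Lemma aeI (P Q : R * R -> Prop) : {ae nu, forall s, P s} -> {ae nu, forall s, Q s} ->
  {ae nu, forall s, P s /\ Q s}.
Proof. by apply: filterS2. Qed.

Lemma measurable_inv : measurable_fun setT (@GRing.inv R).
Proof.
rewrite -(setUv [set 0 : R]); apply/measurable_funU; [|exact: measurableC|split].
- exact: measurable_set1.
- exact: measurable_fun_set1.
- apply: open_continuous_measurable_fun; first exact/closed_openC/closed_eq.
  by move=> x; rewrite inE /= => /eqP x0; exact: inv_continuous.
Qed.

Lemma ess_bounded_integrable u : ess_bounded u -> nu.-integrable setT (EFin \o u).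
Proof.
case=> mu [M uM]; apply/integrableP; split; first exact/measurable_EFinP.
apply: (@le_lt_trans _ _ (\int[nu]_x (cst `|M|%:E) x)%E); last first.
  rewrite integral_cst // [X in (_ * X)%E](_ : _ = 1%E) ?mule1 ?ltry //; exact: probability_setT.
apply: ae_ge0_le_integral => //.
- by do 2 apply: measurableT_comp => //.
- by move=> s _ /=; rewrite lee_fin.
- by apply: filterS uM => s us _; rewrite lee_fin (le_trans us) // ler_norm.
Qed.

Lemma ess_bounded_cst r : ess_bounded (fun=> r).
Proof. by split; [exact: measurable_cst | exists `|r|; apply: aeW]. Qed.

Lemma ess_boundedD u v : ess_bounded u -> ess_bounded v ->
  ess_bounded (fun s => u s + v s).
Proof.
case=> mu [M uM] [mv [N vN]]; split; first exact: measurable_funD.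
exists (M + N); apply: filterS2 uM vN => s us vs.
exact: le_trans (ler_normD _ _) (lerD us vs).
Qed.

Lemma ess_boundedM u v : ess_bounded u -> ess_bounded v ->
  ess_bounded (fun s => u s * v s).
Proof.
case=> mu [M uM] [mv [N vN]]; split; first exact: measurable_funM.
by exists (M * N); apply: filterS2 uM vN => s us vs; rewrite normrM ler_pM.
Qed.

Lemma ess_boundedN u : ess_bounded u -> ess_bounded (fun s => - u s).
Proof.
case=> mu [M uM]; split; first exact: measurable_funN.
by exists M; apply: filterS uM => s; rewrite normrN.
Qed.

Local Notation rint u := (fine (\int[nu]_x (u x)%:E)).

Lemma rintD u v : ess_bounded u -> ess_bounded v ->
  rint (fun s => u s + v s) = rint u + rint v.
Proof. by move=> bu bv; apply: RintegralD => //; exact: ess_bounded_integrable. Qed.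

Lemma rintZ r u : ess_bounded u -> rint (fun s => r * u s) = r * rint u.
Proof. by move=> bu; apply: RintegralZl => //; exact: ess_bounded_integrable. Qed.

Lemma rintN u : ess_bounded u -> rint (fun s => - u s) = - rint u.
Proof.
move=> bu; rewrite -mulN1r -rintZ //; congr fine; apply: eq_integral => s _.
by rewrite mulN1r.
Qed.

Lemma rint_cst r : rint (fun=> r) = r.
Proof.
by have := @Rintegral_cst _ _ _ nu setT measurableT r; rewrite [X in fine X]probability_setT mulr1.
Qed.

Lemma rint_ae_eq u v : measurable_fun setT u -> measurable_fun setT v ->
  {ae nu, forall s, u s = v s} -> rint u = rint v.
Proof.
move=> mu mv uv; congr fine; apply: ae_eq_integral => //.
- exact/measurable_EFinP.
- exact/measurable_EFinP.
- by apply: filterS uv => s + _ => ->.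
Qed.

Lemma rint_ge0 u : measurable_fun setT u -> {ae nu, forall s, 0 <= u s} -> 0 <= rint u.
Proof.
move=> mu u0; rewrite (@rint_ae_eq u (fun s => `|u s|)) //.
- by apply/fine_ge0/integral_ge0 => s _; rewrite lee_fin.
- exact: measurableT_comp.
- by apply: filterS u0 => s us; rewrite ger0_norm.
Qed.

Lemma rint_ae_le u v : ess_bounded u -> ess_bounded v ->
  {ae nu, forall s, u s <= v s} -> rint u <= rint v.
Proof.
move=> bu bv uv; rewrite -subr_ge0 -rintN // -rintD //; last exact: ess_boundedN.
apply: rint_ge0; last by apply: filterS uv => s; rewrite subr_ge0.
by case: (ess_boundedD bv (ess_boundedN bu)).
Qed.

Definition cbounded f : Prop :=
  ess_bounded (fun s => complex.Re (f s)) /\ ess_bounded (fun s => complex.Im (f s)).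

Lemma cbounded_measurable f :
  measurable_fun setT (fun s => complex.Re (f s)) ->
  measurable_fun setT (fun s => complex.Im (f s)) ->
  (exists M, {ae nu, forall s, cabs (f s) <= M}) -> cbounded f.
Proof.
move=> mr mi [M fM]; split; split=> //; exists M; apply: filterS fM => s.
- exact/le_trans/normr_Re_le.
- exact/le_trans/normr_Im_le.
Qed.

Lemma cbounded_cst c : cbounded (fun=> c).
Proof. by split; exact: ess_bounded_cst. Qed.

Lemma cboundedD f g : cbounded f -> cbounded g -> cbounded (fun s => f s + g s).
Proof.
move=> [fr fi] [gr gi]; split.
- under [X in ess_bounded X]eq_fun do rewrite cReD; exact: ess_boundedD.
- under [X in ess_bounded X]eq_fun do rewrite cImD; exact: ess_boundedD.
Qed.

Lemma cboundedM f g : cbounded f -> cbounded g -> cbounded (fun s => f s * g s).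
Proof.
move=> [fr fi] [gr gi]; split.
- under [X in ess_bounded X]eq_fun do rewrite cReM.
  by apply: ess_boundedD; [|apply: ess_boundedN]; exact: ess_boundedM.
- under [X in ess_bounded X]eq_fun do rewrite cImM.
  by apply: ess_boundedD; exact: ess_boundedM.
Qed.

Lemma cboundedN f : cbounded f -> cbounded (fun s => - f s).
Proof.
move=> [fr fi]; split.
- under [X in ess_bounded X]eq_fun do rewrite cReN; exact: ess_boundedN.
- under [X in ess_bounded X]eq_fun do rewrite cImN; exact: ess_boundedN.
Qed.

Lemma cboundedB f g : cbounded f -> cbounded g -> cbounded (fun s => f s - g s).
Proof. by move=> bf bg; apply: cboundedD => //; exact: cboundedN. Qed.

Lemma cboundedZ c f : cbounded f -> cbounded (fun s => c * f s).
Proof. by apply: cboundedM; exact: cbounded_cst. Qed.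

Lemma cboundedX f n : cbounded f -> cbounded (fun s => f s ^+ n).
Proof.
move=> bf; elim: n => [|n ih]; first exact: (cbounded_cst 1).
under [X in cbounded X]eq_fun do rewrite exprS; exact: cboundedM.
Qed.

Lemma cbounded_conj f : cbounded f -> cbounded (fun s => (f s)^*%C).
Proof.
move=> [fr fi]; split.
- by rewrite (_ : (fun _ => _) = fun s => complex.Re (f s)) //; apply/funext => s; case: (f s).
- rewrite (_ : (fun _ => _) = fun s => - complex.Im (f s)); last first.
    by apply/funext => s; case: (f s).
  exact: ess_boundedN.
Qed.

Lemma cbounded_inv f c : 0 < c -> cbounded f ->
  {ae nu, forall s, c <= cabs (f s)} -> cbounded (fun s => (f s)^-1).
Proof.
move=> c0 bf cf; have [[mr _] [mi _]] := bf.
have minv : measurable_fun setT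
    (fun s => (complex.Re (f s) ^+ 2 + complex.Im (f s) ^+ 2)^-1).
  apply: (measurableT_comp measurable_inv).
  by apply: measurable_funD; apply: measurable_funX.
have e s : (f s)^-1 = ((complex.Re (f s) ^+ 2 + complex.Im (f s) ^+ 2)^-1)%:C%C * (f s)^*%C.
  by case: (f s) => x y; apply: complex_eq; rewrite /= ?mul0r ?subr0 ?addr0 mulrC // mulrN.
apply: cbounded_measurable.
- rewrite (_ : (fun _ => _) = fun s =>
    (complex.Re (f s) ^+ 2 + complex.Im (f s) ^+ 2)^-1 * complex.Re (f s)).
    exact: measurable_funM.
  by apply/funext => s; rewrite e; case: (f s) => x y /=; rewrite mul0r subr0.
- rewrite (_ : (fun _ => _) = fun s =>
    (complex.Re (f s) ^+ 2 + complex.Im (f s) ^+ 2)^-1 * - complex.Im (f s)).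
    by apply: measurable_funM => //; apply: measurable_funN.
  by apply/funext => s; rewrite e; case: (f s) => x y /=; rewrite mul0r addr0.
- exists c^-1; apply: filterS cf => s cs; rewrite cabsV lef_pV2 ?posrE //.
  exact: lt_le_trans cs.
Qed.

Local Notation E := (fm_cint nu).

Lemma cintD f g : cbounded f -> cbounded g -> E (fun s => f s + g s) = E f + E g.
Proof.
move=> [fr fi] [gr gi]; apply: complex_eq; rewrite /fm_cint /= -rintD //.
- by congr fine; apply: eq_integral => s _; rewrite cReD.
- by congr fine; apply: eq_integral => s _; rewrite cImD.
Qed.

Lemma cintZ c f : cbounded f -> E (fun s => c * f s) = c * E f.
Proof.
move=> [fr fi]; apply: complex_eq; rewrite ?cReM ?cImM /fm_cint /=.
- rewrite -!rintZ // -rintN -?rintD //.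
  + by congr fine; apply: eq_integral => s _; rewrite cReM.
  + by apply: ess_boundedM => //; exact: ess_bounded_cst.
  + by apply/ess_boundedN/ess_boundedM => //; exact: ess_bounded_cst.
  + by apply: ess_boundedM => //; exact: ess_bounded_cst.
- rewrite -!rintZ // -rintD //.
  + by congr fine; apply: eq_integral => s _; rewrite cImM.
  + by apply: ess_boundedM => //; exact: ess_bounded_cst.
  + by apply: ess_boundedM => //; exact: ess_bounded_cst.
Qed.

Lemma cintN f : cbounded f -> E (fun s => - f s) = - E f.
Proof.
move=> bf; rewrite -mulN1r -cintZ //; congr fm_cint; apply/funext => s.
by rewrite mulN1r.
Qed.

Lemma cintB f g : cbounded f -> cbounded g -> E (fun s => f s - g s) = E f - E g.
Proof. by move=> bf bg; rewrite cintD // ?cintN //; exact: cboundedN. Qed.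

Lemma cint_cst c : E (fun=> c) = c.
Proof. by apply: complex_eq; rewrite /= rint_cst. Qed.

Lemma cint_conj f : cbounded f -> E (fun s => (f s)^*%C) = (E f)^*%C.
Proof.
move=> [fr fi]; apply: complex_eq; rewrite /=.
- by congr fine; apply: eq_integral => s _; case: (f s).
- by rewrite -rintN //; congr fine; apply: eq_integral => s _; case: (f s).
Qed.

Lemma cint_ae_eq f g : cbounded f -> cbounded g ->
  {ae nu, forall s, f s = g s} -> E f = E g.
Proof.
move=> [[fr _] [fi _]] [[gr _] [gi _]] fg; rewrite /fm_cint; congr (_ +i* _)%C.
- by apply: rint_ae_eq => //; apply: filterS fg => s ->.
- by apply: rint_ae_eq => //; apply: filterS fg => s ->.
Qed.

Lemma Re_cint_le f g : cbounded f -> cbounded g ->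
  {ae nu, forall s, complex.Re (f s) <= complex.Re (g s)} ->
  complex.Re (E f) <= complex.Re (E g).
Proof. by move=> [fr _] [gr _] fg; exact: rint_ae_le. Qed.

Lemma Re_cint_sqr_ge0 f : cbounded f -> 0 <= complex.Re (E (fun s => f s * (f s)^*%C)).
Proof.
move=> bf; rewrite -[leLHS]/(complex.Re (0 : C)) -{1}(cint_cst 0); apply: Re_cint_le.
- exact: cbounded_cst.
- by apply: cboundedM => //; exact: cbounded_conj.
- by apply: aeW => s; rewrite mul_conjc /= sqr_ge0.
Qed.

(* Rotate [E f] onto the positive reals before comparing real parts. *)
Lemma cabs_cint_le f M : cbounded f -> {ae nu, forall s, cabs (f s) <= M} -> cabs (E f) <= M.
Proof.
move=> bf fM; have [->|e0] := eqVneq (E f) 0.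
  rewrite cabs0 leNgt; apply/negP => M0.
  have : 1 <= complex.Re (E (fun=> 0)).
    rewrite -{1}(rint_cst 1); apply: rint_ae_le; [exact: ess_bounded_cst..|].
    apply: filterS fM => s fs; exfalso.
    by have := lt_le_trans M0 (le_trans (cabs_ge0 (f s)) fs); rewrite ltxx.
  by rewrite cint_cst /= ler10.
have a0 : cabs (E f) != 0 by rewrite cabs_eq0.
pose c := (E f)^*%C / (cabs (E f))%:C%C.
have c1 : cabs c = 1.
  by rewrite /c cabs_div cabs_conj cabs_real ger0_norm ?cabs_ge0 // divff.
have -> : cabs (E f) = complex.Re (E (fun s => c * f s)).
  rewrite cintZ // /c mulrAC [_^*%C * _]mulrC mul_conjc expr2 rmorphM mulfK //.
  by apply: contra a0 => /eqP[->].
rewrite -{1}(rint_cst M); apply: rint_ae_le; first by case: (cboundedZ c bf).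
  exact: ess_bounded_cst.
apply: filterS fM => s; apply: le_trans; apply: le_trans (Re_le_cabs _) _.
by rewrite cabsM c1 mul1r.
Qed.

(** For real x and B the integral of f conj(g), the integral of |f - x B g|^2 is a nonnegative
    quadratic polynomial in x, with minimum at x = 1 / G when G is nonzero. *)
Lemma cint_cauchy_schwarz f g : cbounded f -> cbounded g ->
  cabs (E (fun s => f s * (g s)^*%C)) ^+ 2 <=
  complex.Re (E (fun s => f s * (f s)^*%C)) * complex.Re (E (fun s => g s * (g s)^*%C)).
Proof.
move=> bf bg; set B := E (fun s => f s * (g s)^*%C).
set F := complex.Re _; set G := complex.Re _.
have bff := cboundedM bf (cbounded_conj bf); have bgg := cboundedM bg (cbounded_conj bg).
have bfg := cboundedM bf (cbounded_conj bg).
have key (x : R) : 0 <= F - 2 * x * cabs B ^+ 2 + x ^+ 2 * cabs B ^+ 2 * G.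
  pose c : C := x%:C%C * B.
  have := Re_cint_sqr_ge0 (cboundedB bf (cboundedZ c bg)).
  have -> : E (fun s => (f s - c * g s) * (f s - c * g s)^*%C) =
      E (fun s => f s * (f s)^*%C) - c^*%C * B - c * B^*%C + c * c^*%C * E (fun s => g s * (g s)^*%C).
    have bgf := cbounded_conj bfg.
    transitivity (E (fun s => (f s * (f s)^*%C + - c^*%C * (f s * (g s)^*%C)) +
        (- c * (f s * (g s)^*%C)^*%C + c * c^*%C * (g s * (g s)^*%C)))).
      congr fm_cint; apply/funext => s; by rewrite conjcD conjcN !conjcM conjcK; ring.
    have b1 := cboundedZ (- c^*%C) bfg; have b2 := cboundedZ (- c) bgf.
    have b3 := cboundedZ (c * c^*%C) bgg.
    rewrite (cintD (cboundedD bff b1) (cboundedD b2 b3)) (cintD bff b1) (cintD b2 b3).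
    by rewrite !cintZ // cint_conj // -/B; ring.
  have -> : c^*%C * B = (x * cabs B ^+ 2)%:C%C.
    by rewrite /c conjcM conjc_real -mulrA [_^*%C * _]mulrC mul_conjc -rmorphM.
  have -> : c * B^*%C = (x * cabs B ^+ 2)%:C%C.
    by rewrite /c -mulrA mul_conjc -rmorphM.
  have -> : c * c^*%C = (x ^+ 2 * cabs B ^+ 2)%:C%C.
    by rewrite mul_conjc /c cabsM cabs_real exprMn real_normK ?num_real.
  rewrite !(cReD, cReN, cReM) /= -/F -/G => H.
  by apply: le_trans H _; rewrite /F /G /= le_eqVlt; apply/orP; left; apply/eqP; ring.
have F0 : 0 <= F by exact: Re_cint_sqr_ge0.
have G0 : 0 <= G by exact: Re_cint_sqr_ge0.
have B0 : 0 <= cabs B ^+ 2 by exact: sqr_ge0.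
have [G0'|Gn0] := eqVneq G 0; last first.
  have := key G^-1; have -> : G^-1 ^+ 2 * cabs B ^+ 2 * G = G^-1 * cabs B ^+ 2.
    by rewrite expr2; field.
  have Gp : 0 < G by rewrite lt_neqAle eq_sym Gn0.
  move=> H; have H2 : G^-1 * cabs B ^+ 2 <= F by move: H; lra.
  by rewrite -(ler_pM2l (x := G^-1)) ?invr_gt0 // (le_trans H2) // mulrCA mulVf // mulr1.
rewrite G0' mulr0 leNgt; apply/negP => Bp.
(* With G = 0 the polynomial is affine in x, and this x makes it equal to -F - 2. *)
have := key ((F + 1) / cabs B ^+ 2); rewrite G0' mulr0 addr0 -mulrA divfK ?gt_eqF //.
by lra.
Qed.

End BoundedFunctions.

(** * The resolvent, its second moments and the covariance kernel *)

Section Resolvent.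
Variables (R : realType) (nu : probability (R * R)%type R).
Hypothesis nuT : prob_on_T nu.
Local Notation C := R[i].
Local Notation cabs := (@fm_cabs R).
Local Notation toC := (@fm_toC R).
Local Notation E := (fm_cint nu).
Implicit Types z w : C.

Definition rsv z (s : R * R) : C := (1 - z * toC s)^-1.

Definition away z (c : R) : Prop := {ae nu, forall s, c <= cabs (1 - z * toC s)}.

Definition regular z : Prop := exists2 c : R, 0 < c & away z c.

(* [mrsv] is psi + 1 and [hfun] is eta(z) / z. The kernel [Kfun z w] equals
   (1 - hfun z * conj (hfun w)) / (1 - z * conj w); as a normalised covariance it is positive
   semidefinite, and its diagonal [kfun] is t eta'(t) / eta(t) - 1 at points t of the circle. *)
Definition mrsv z : C := E (rsv z).
Definition brsv z : C := E (fun s => toC s * rsv z s).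
Definition grsv z w : C := E (fun s => rsv z s * (rsv w s)^*%C).
Definition nrsv z : R := complex.Re (grsv z z).
Definition hfun z : C := brsv z / mrsv z.
Definition covr z w : C := grsv z w - brsv z * (brsv w)^*%C.
Definition kfun z : R := complex.Re (covr z z) / cabs (mrsv z) ^+ 2.
Definition Kfun z w : C := covr z w / (mrsv z * (mrsv w)^*%C).

Lemma measurable_Tset : measurable (@fm_Tset R).
Proof.
rewrite (_ : @fm_Tset R = setT `&` (fun s : R * R => s.1 ^+ 2 + s.2 ^+ 2) @^-1` [set 1]).
  have mf : measurable_fun setT (fun s : R * R => s.1 ^+ 2 + s.2 ^+ 2).
    by apply: measurable_funD; apply: measurable_funX.
  by apply: mf => //; exact: measurable_set1.
by rewrite setTI.
Qed.

Lemma measurable_eball (p : R * R) (e : R) : measurable (fm_eball p e).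
Proof.
rewrite (_ : fm_eball p e = setT `&`
    (fun s : R * R => (s.1 - p.1) ^+ 2 + (s.2 - p.2) ^+ 2) @^-1` `]-oo, e ^+ 2[).
  have mf : measurable_fun setT (fun s : R * R => (s.1 - p.1) ^+ 2 + (s.2 - p.2) ^+ 2).
    by apply: measurable_funD; apply: measurable_funX; apply: measurable_funB.
  by apply: mf => //; exact: measurable_itv.
by rewrite setTI; apply/seteqP; split => s /=; rewrite in_itv.
Qed.

Lemma eballE (p : C) e s : 0 < e ->
  fm_eball (fm_fromC p) e s <-> cabs (toC s - p) < e.
Proof.
move=> e0; rewrite /fm_eball /= -(@ltr_sqr _ (cabs _)) ?nnegrE ?cabs_ge0 ?ltW //.
by rewrite cabs_sqr; case: p.
Qed.

Lemma ae_unit : {ae nu, forall s, cabs (toC s) = 1}.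
Proof.
exists (~` @fm_Tset R); split; [by apply: measurableC; exact: measurable_Tset| |].
  by rewrite probability_setC ?nuT ?subee //; exact: measurable_Tset.
apply: subsetC => s /= sT; apply/eqP; rewrite -(@eqrXn2 _ 2) ?cabs_ge0 // expr1n.
by apply/eqP; rewrite cabs_sqr.
Qed.

Lemma cbounded_toC : cbounded nu toC.
Proof.
apply: cbounded_measurable; [exact: measurable_fst|exact: measurable_snd|].
by exists 1; apply: filterS ae_unit => s ->.
Qed.

Lemma away_le z c c' : c' <= c -> away z c -> away z c'.
Proof. by move=> cc; apply: filterS => s; exact: le_trans. Qed.

Lemma cbounded_rsv z : regular z -> cbounded nu (rsv z).
Proof.
case=> c c0 zc; apply: cbounded_inv c0 _ zc.
apply: cboundedB; first exact: cbounded_cst.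
exact/cboundedZ/cbounded_toC.
Qed.

Lemma rsvK z : regular z -> {ae nu, forall s, (1 - z * toC s) * rsv z s = 1}.
Proof.
case=> c c0; apply: filterS => s cs; rewrite /rsv divff // -cabs_gt0.
exact: lt_le_trans cs.
Qed.

Lemma regular_disk z : cabs z < 1 -> regular z.
Proof.
move=> z1; exists (1 - cabs z); first by rewrite subr_gt0.
apply: filterS ae_unit => s s1.
by apply: le_trans (cabs_ge_sub _ _); rewrite cabs1 cabsM s1 mulr1.
Qed.

(** Some ball around 1/z has measure zero, and |1 - z s| = |s - 1/z| for unimodular z. *)
Lemma regular_Cset z : fm_Cset nu z -> regular z.
Proof.
case=> z1 /existsNP[e /not_implyP[e0 /negP]]; rewrite -leNgt => ne.
exists e => //; have z0 := cabs1_neq0 z1.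
have aeb : {ae nu, forall s, ~ fm_eball (fm_fromC z^-1) e s}.
  exists (fm_eball (fm_fromC z^-1) e); split; first exact: measurable_eball.
    by apply/eqP; rewrite eq_le ne measure_ge0.
  by move=> s /= /contrapT.
apply: filterS aeb => s /(contra_not (eballE _ _ e0).2) /negP; rewrite -leNgt.
move=> h; apply: le_trans h _.
have -> : 1 - z * toC s = - z * (toC s - z^-1) by rewrite mulrBr mulNr mulNr divff //; ring.
by rewrite cabsM cabsN z1 mul1r.
Qed.

Lemma away_near z w c : away z c -> away w (c - cabs (w - z)).
Proof.
move=> zc; apply: filterS2 zc ae_unit => s cs s1; rewrite lerBlDr (le_trans cs) //.
have -> : 1 - z * toC s = (1 - w * toC s) + (w - z) * toC s by ring.
by rewrite (le_trans (cabsD _ _)) // cabsM s1 mulr1.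
Qed.

Lemma cbounded_brsv z : regular z -> cbounded nu (fun s => toC s * rsv z s).
Proof. by move=> rz; apply: cboundedM; [exact: cbounded_toC|exact: cbounded_rsv]. Qed.

Lemma cbounded_grsv z w : regular z -> regular w ->
  cbounded nu (fun s => rsv z s * (rsv w s)^*%C).
Proof. by move=> rz rw; apply: cboundedM; [|apply: cbounded_conj]; exact: cbounded_rsv. Qed.

Lemma mrsv_brsv z : regular z -> mrsv z = 1 + z * brsv z.
Proof.
move=> rz; have bz := cbounded_brsv rz.
rewrite /mrsv /brsv -cintZ // -[X in X + _](cint_cst nu 1) -cintD; [|exact: cbounded_cst|exact: cboundedZ].
apply: cint_ae_eq; [exact: cbounded_rsv| |].
  by apply: cboundedD; [exact: cbounded_cst|exact: cboundedZ].
by apply: filterS (rsvK rz) => s {1}<-; ring.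
Qed.

(** For unimodular s, X + conj(Y) - 1 = (1 - z conj(w)) X conj(Y) holds pointwise with X = [rsv z s]
    and Y = [rsv w s]; the lemma is the integrated form. *)
Lemma grsvE z w : regular z -> regular w ->
  (1 - z * w^*%C) * grsv z w = mrsv z + (mrsv w)^*%C - 1.
Proof.
move=> rz rw; have bz := cbounded_rsv rz; have bw := cbounded_rsv rw.
have bc := cbounded_conj bw; have b1 := cbounded_cst nu (1 : C).
rewrite /grsv -cintZ; last exact: cbounded_grsv.
rewrite /mrsv -cint_conj // -cintD // -[X in _ = _ - X](cint_cst nu 1) -cintB //; last exact: cboundedD.
apply: cint_ae_eq; [exact/cboundedZ/cbounded_grsv|by apply: cboundedB => //; apply: cboundedD|].
have s1 := ae_unit; apply: filterS3 (rsvK rz) (rsvK rw) s1 => s zs ws s1.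
have ss : toC s * (toC s)^*%C = 1 by rewrite mul_conjc s1 expr1n.
have wc : (1 - w^*%C * (toC s)^*%C) * (rsv w s)^*%C = 1.
  by rewrite -conjcM -{1}(conjc1 R) -conjcN -conjcD -conjcM ws conjc1.
set X := rsv z s in zs *; set Y := (rsv w s)^*%C in wc *.
have -> : X + Y - 1 = X * ((1 - w^*%C * (toC s)^*%C) * Y) + Y * ((1 - z * toC s) * X)
    - ((1 - w^*%C * (toC s)^*%C) * Y) * ((1 - z * toC s) * X) by rewrite zs wc; ring.
have -> : 1 - z * w^*%C = 1 - z * w^*%C * (toC s * (toC s)^*%C) by rewrite ss mulr1.
by ring.
Qed.

Lemma grsv_conj z w : regular z -> regular w -> (grsv z w)^*%C = grsv w z.
Proof.
move=> rz rw; rewrite -cint_conj; last exact: cbounded_grsv.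
by congr fm_cint; apply/funext => s; rewrite conjcM conjcK mulrC.
Qed.

Lemma real_of_conj (x : C) : x^*%C = x -> x = (complex.Re x)%:C%C.
Proof. by case: x => x y [] /eqP; rewrite eq_sym -subr_eq0 opprK -mulr2n mulrn_eq0 /= => /eqP->. Qed.

Lemma grsvR z : regular z -> grsv z z = (nrsv z)%:C%C.
Proof. by move=> rz; apply: real_of_conj; exact: grsv_conj. Qed.

Lemma covrR z : regular z -> covr z z = (nrsv z - cabs (brsv z) ^+ 2)%:C%C.
Proof. by move=> rz; rewrite /covr grsvR // mul_conjc -rmorphB. Qed.

Lemma Re_mrsv z : regular z -> 2 * complex.Re (mrsv z) - 1 = (1 - cabs z ^+ 2) * nrsv z.
Proof.
move=> rz; have := grsvE rz rz; rewrite grsvR // mul_conjc -rmorphB -rmorphM.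
move=> /(congr1 (@complex.Re R)) /= ->; case: (mrsv z) => x y /=; ring.
Qed.

Lemma nrsv_ge z : regular z -> cabs (mrsv z) ^+ 2 <= nrsv z.
Proof.
move=> rz; have := cint_cauchy_schwarz (cbounded_rsv rz) (cbounded_cst nu (1 : C)).
have e1 : (fun s => rsv z s * 1^*%C) = rsv z by apply/funext => s; rewrite conjc1 mulr1.
have e2 : (fun s : R * R => 1 * 1^*%C) = (fun=> 1 : C) by apply/funext => s; rewrite conjc1 mulr1.
by rewrite e1 e2 cint_cst mulr1.
Qed.

(** The right-hand side of [Re_mrsv] is nonnegative. This keeps psi + 1 away from 0 at all regular
    points of the closed disk, so eta and h are genuine quotients there. *)
Lemma Re_mrsv_ge z : regular z -> cabs z <= 1 -> 2^-1 <= complex.Re (mrsv z).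
Proof.
move=> rz z1; have := Re_mrsv rz; have := nrsv_ge rz; have := sqr_ge0 (cabs (mrsv z)).
have : cabs z ^+ 2 <= 1 by rewrite expr_le1 ?cabs_ge0.
by nra.
Qed.

Lemma cabs_mrsv_ge z : regular z -> cabs z <= 1 -> 2^-1 <= cabs (mrsv z).
Proof. by move=> rz z1; exact: le_trans (Re_mrsv_ge rz z1) (Re_le_cabs _). Qed.

Lemma mrsv_neq0 z : regular z -> cabs z <= 1 -> mrsv z != 0.
Proof. by move=> rz z1; rewrite -cabs_gt0; apply: lt_le_trans (cabs_mrsv_ge rz z1). Qed.

Lemma nrsv_ge14 z : regular z -> cabs z <= 1 -> 4^-1 <= nrsv z.
Proof.
move=> rz z1; apply: le_trans (nrsv_ge rz).
by have := cabs_mrsv_ge rz z1; nra.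
Qed.

Lemma psi_mrsv z : regular z -> fm_psi nu z = mrsv z - 1.
Proof.
move=> rz; have bz := cbounded_rsv rz; have b1 := cbounded_cst nu (1 : C).
rewrite /mrsv -[X in _ = _ - X](cint_cst nu 1) -cintB //; apply: cint_ae_eq.
- have bb := cboundedZ z (cbounded_brsv rz).
  by rewrite (_ : (fun _ => _) = fun s => z * (toC s * rsv z s)) //; apply/funext => s; rewrite mulrA.
- exact: cboundedB.
- by apply: filterS (rsvK rz) => s zs; rewrite -/(rsv z s) -[X in _ = _ - X]zs; ring.
Qed.

Lemma eta_mrsv z : regular z -> cabs z <= 1 -> fm_eta nu z = 1 - (mrsv z)^-1.
Proof.
move=> rz z1; have a0 := mrsv_neq0 rz z1.
by rewrite /fm_eta psi_mrsv // addrCA subrr addr0 mulrBl divff // mul1r.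
Qed.

Lemma eta_hfun z : regular z -> cabs z <= 1 -> fm_eta nu z = z * hfun z.
Proof.
move=> rz z1; have a0 := mrsv_neq0 rz z1.
by rewrite eta_mrsv // /hfun mulrA -[z * _](addKr 1) -mrsv_brsv // mulrDl divff // addrC mulN1r.
Qed.

Lemma covr_kernel z w : regular z -> regular w ->
  mrsv z * (mrsv w)^*%C - brsv z * (brsv w)^*%C = (1 - z * w^*%C) * covr z w.
Proof.
move=> rz rw; rewrite /covr mulrBr grsvE // !mrsv_brsv // conjcD conjcM conjc1; ring.
Qed.

(** This is [covr_kernel] divided by the values of [mrsv]; it shows that [Kfun] is the de
    Branges-Rovnyak kernel of [hfun]. *)
Lemma hfun_kernel z w : regular z -> regular w -> cabs z <= 1 -> cabs w <= 1 ->
  1 - hfun z * (hfun w)^*%C = (1 - z * w^*%C) * Kfun z w.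
Proof.
move=> rz rw z1 w1; have az := mrsv_neq0 rz z1.
have aw : (mrsv w)^*%C != 0 by rewrite conjc_eq0 mrsv_neq0.
rewrite /hfun /Kfun mulrA -covr_kernel // conjcM conjc_inv; field.
by rewrite az aw.
Qed.

(** As |s| = 1, [nrsv z] is also the integral of |s X_z|^2. The quantity is thus a variance, and
    Cauchy-Schwarz against the constant 1 applies. *)
Lemma covr_ge0 z : regular z -> 0 <= complex.Re (covr z z).
Proof.
move=> rz; rewrite covrR //= subr_ge0.
have := cint_cauchy_schwarz (cbounded_brsv rz) (cbounded_cst nu (1 : C)).
have e1 : (fun s => toC s * rsv z s * 1^*%C) = fun s => toC s * rsv z s.
  by apply/funext => s; rewrite conjc1 mulr1.
have e2 : (fun s : R * R => 1 * 1^*%C) = (fun=> 1 : C) by apply/funext => s; rewrite conjc1 mulr1.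
rewrite e1 e2 cint_cst mulr1 => /le_trans; apply; rewrite le_eqVlt; apply/orP; left; apply/eqP.
rewrite /nrsv; congr complex.Re; apply: cint_ae_eq.
- by apply: cboundedM; [|apply: cbounded_conj]; exact: cbounded_brsv.
- exact: cbounded_grsv.
- apply: filterS ae_unit => s s1.
  by rewrite conjcM mulrACA [toC s * _]mul_conjc s1 expr1n mul1r.
Qed.

Lemma kfun_ge0 z : regular z -> 0 <= kfun z.
Proof. by move=> rz; rewrite /kfun divr_ge0 ?sqr_ge0 ?covr_ge0. Qed.

(** A covariance is the inner product of the centred functions s X_z - [brsv z] and s X_w -
    [brsv w]. *)
Lemma covr_cauchy_schwarz z w : regular z -> regular w ->
  cabs (covr z w) ^+ 2 <= complex.Re (covr z z) * complex.Re (covr w w).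
Proof.
have cc x y : regular x -> regular y -> covr x y =
    E (fun s => (toC s * rsv x s - brsv x) * (toC s * rsv y s - brsv y)^*%C).
  move=> rx ry; have bx := cbounded_brsv rx; have by_ := cbounded_brsv ry.
  have bg := cboundedM bx (cbounded_conj by_).
  have bc := cbounded_conj by_.
  transitivity (E (fun s => (toC s * rsv x s * (toC s * rsv y s)^*%C +
     - (brsv y)^*%C * (toC s * rsv x s)) +
     (- brsv x * (toC s * rsv y s)^*%C + brsv x * (brsv y)^*%C))); last first.
    by congr fm_cint; apply/funext => s; rewrite conjcD conjcN; ring.
  have b1 := cboundedZ (- (brsv y)^*%C) bx; have b2 := cboundedZ (- brsv x) bc.
  have b3 := cbounded_cst nu (brsv x * (brsv y)^*%C).
  rewrite (cintD (cboundedD bg b1) (cboundedD b2 b3)) (cintD bg b1) (cintD b2 b3).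
  rewrite (cintZ _ bx) (cintZ _ bc) (cint_conj by_) cint_cst -/(brsv x) -/(brsv y) /covr.
  have -> : grsv x y = E (fun s => toC s * rsv x s * (toC s * rsv y s)^*%C).
    apply: cint_ae_eq => //; first exact: cbounded_grsv.
    apply: filterS ae_unit => s s1.
    by rewrite conjcM mulrACA [toC s * _]mul_conjc s1 expr1n mul1r.
  by ring.
move=> rz rw; rewrite !cc //; apply: cint_cauchy_schwarz.
- by apply: cboundedB; [exact: cbounded_brsv|exact: cbounded_cst].
- by apply: cboundedB; [exact: cbounded_brsv|exact: cbounded_cst].
Qed.

Lemma grsv_cauchy_schwarz z w : regular z -> regular w ->
  cabs (grsv z w) ^+ 2 <= nrsv z * nrsv w.
Proof. by move=> rz rw; apply: cint_cauchy_schwarz; exact: cbounded_rsv. Qed.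

Lemma Kfun_cauchy_schwarz z w : regular z -> regular w ->
  cabs (Kfun z w) ^+ 2 <= kfun z * kfun w.
Proof.
move=> rz rw; rewrite /Kfun /kfun cabs_div expr_div_n cabsM cabs_conj exprMn mulf_div.
by rewrite ler_wpM2r ?covr_cauchy_schwarz // invr_ge0 mulr_ge0 ?sqr_ge0.
Qed.

(** The diagonal of [hfun_kernel]. It turns the fixed-point equations into linear relations between
    the defects 1 - |z|^2, 1 - |w1|^2 and 1 - |w2|^2. *)
Lemma hfun_cabs z : regular z -> cabs z <= 1 ->
  1 - cabs (hfun z) ^+ 2 = (1 - cabs z ^+ 2) * kfun z.
Proof.
move=> rz z1; have e := hfun_kernel rz rz z1 z1.
have K : Kfun z z = (kfun z)%:C%C.
  by rewrite /Kfun /kfun mul_conjc covrR //= -fmorph_div.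
by move: e; rewrite K !mul_conjc => /(congr1 (@complex.Re R)); rewrite cReM /= mulr0 subr0.
Qed.

Lemma hfun_le1 z : regular z -> cabs z <= 1 -> cabs (hfun z) <= 1.
Proof.
move=> rz z1; rewrite -(@expr_le1 _ 2) ?cabs_ge0 // -subr_ge0 hfun_cabs //.
by rewrite mulr_ge0 ?kfun_ge0 // subr_ge0 expr_le1 ?cabs_ge0.
Qed.

Lemma kfun_nrsv z : kfun z = (nrsv z - cabs (brsv z) ^+ 2) / cabs (mrsv z) ^+ 2.
Proof. by rewrite /kfun /covr mul_conjc cReD cReN. Qed.

End Resolvent.

(** * Limits of complex-valued functions along filters *)

Section Limits.
Variable R : realType.
Local Notation C := R[i].
Local Notation cabs := (@fm_cabs R).

(** Relative neighbourhoods measured by [fm_cabs], to agree with [fm_cont_within]. As a filter they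
    give access to the [near] tactics and to the limit algebra of real functions. *)
Definition cnear (S : set C) (t : C) : set_system C :=
  [set P | exists2 d : R, 0 < d & forall z, S z -> cabs (z - t) < d -> P z].

Global Instance cnear_filter S t : Filter (cnear S t).
Proof.
split.
- by exists 1.
- move=> P Q [d d0 Pd] [e e0 Qe]; exists (Num.min d e); first by rewrite lt_min d0.
  by move=> z Sz; rewrite lt_min => /andP[zd ze]; split; [exact: Pd|exact: Qe].
- by move=> P Q PQ [d d0 Pd]; exists d => // z Sz zd; exact/PQ/Pd.
Qed.

Definition ctends (X : Type) (F : set_system X) (f : X -> C) (l : C) : Prop :=
  forall e : R, 0 < e -> \forall x \near F, cabs (f x - l) < e.

Section Tends.
Variables (X : Type) (F : set_system X).
Context {FF : Filter F}.
Implicit Types (f g : X -> C) (l m : C).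

Lemma ctendsP f l : ctends F f l <->
  (complex.Re (f x) @[x --> F] --> complex.Re l) /\ (complex.Im (f x) @[x --> F] --> complex.Im l).
Proof.
split=> [fl|[/cvgrPdist_lt fr /cvgrPdist_lt fi] e e0].
  split; apply/cvgrPdist_lt => e e0; apply: filterS (fl _ e0) => x; apply: le_lt_trans.
  - by rewrite -cReN -cReD cabs_distC normr_Re_le.
  - by rewrite -cImN -cImD cabs_distC normr_Im_le.
have e2 : 0 < e / 2 by rewrite divr_gt0.
apply: filterS2 (fr _ e2) (fi _ e2) => x h1 h2; rewrite cabs_distC.
apply: le_lt_trans (cabs_le_ReIm _) _.
by rewrite cReD cReN cImD cImN [e]splitr ltrD.
Qed.

Lemma ctends_cst l : ctends F (fun=> l) l.
Proof. by move=> e e0; apply: filterE => x; rewrite subrr cabs0. Qed.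

Lemma ctendsD f g l m : ctends F f l -> ctends F g m -> ctends F (fun x => f x + g x) (l + m).
Proof.
move=> /ctendsP[fr fi] /ctendsP[gr gi]; apply/ctendsP; split.
- by under eq_fun do rewrite cReD; rewrite cReD; exact: cvgD.
- by under eq_fun do rewrite cImD; rewrite cImD; exact: cvgD.
Qed.

Lemma ctendsN f l : ctends F f l -> ctends F (fun x => - f x) (- l).
Proof.
move=> /ctendsP[fr fi]; apply/ctendsP; split.
- by under eq_fun do rewrite cReN; rewrite cReN; exact: cvgN.
- by under eq_fun do rewrite cImN; rewrite cImN; exact: cvgN.
Qed.

Lemma ctendsB f g l m : ctends F f l -> ctends F g m -> ctends F (fun x => f x - g x) (l - m).
Proof. by move=> fl gm; apply: ctendsD => //; exact: ctendsN. Qed.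

Lemma ctendsM f g l m : ctends F f l -> ctends F g m -> ctends F (fun x => f x * g x) (l * m).
Proof.
move=> /ctendsP[fr fi] /ctendsP[gr gi]; apply/ctendsP; split.
- under eq_fun do rewrite cReM; rewrite cReM.
  by apply: cvgB; exact: cvgM.
- under eq_fun do rewrite cImM; rewrite cImM.
  by apply: cvgD; exact: cvgM.
Qed.

Lemma ctends_conj f l : ctends F f l -> ctends F (fun x => (f x)^*%C) l^*%C.
Proof.
by move=> fl e e0; apply: filterS (fl _ e0) => x; rewrite -conjcN -conjcD cabs_conj.
Qed.

Lemma ctends_cabs f l : ctends F f l -> cabs (f x) @[x --> F] --> cabs l.
Proof.
move=> fl; apply/cvgrPdist_lt => e e0; apply: filterS (fl _ e0) => x; apply: le_lt_trans.
by rewrite ler_norml lerNl opprB cabs_ge_sub cabs_distC cabs_ge_sub.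
Qed.

Lemma ctends_real (u : X -> R) (r : R) :
  u x @[x --> F] --> r -> ctends F (fun x => (u x)%:C%C) r%:C%C.
Proof. by move=> ur; apply/ctendsP; split => //=; exact: cvg_cst. Qed.

Lemma invc_conj (z : C) : z^-1 = ((cabs z ^+ 2)^-1)%:C%C * z^*%C.
Proof.
have [->|z0] := eqVneq z 0; first by rewrite conjc0 mulr0 invr0.
rewrite fmorphV /= -mul_conjc invfM mulrVK ?unitfE ?conjc_eq0 //.
Qed.

Lemma ctendsV f l : l != 0 -> ctends F f l -> ctends F (fun x => (f x)^-1) l^-1.
Proof.
move=> l0 fl; rewrite [l^-1]invc_conj; under eq_fun do rewrite invc_conj.
apply: ctendsM; last exact: ctends_conj.
apply: ctends_real; apply: cvgV; first by rewrite expf_neq0 ?cabs_eq0.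
by rewrite expr2; under eq_fun do rewrite expr2; apply: cvgM; exact: ctends_cabs.
Qed.

Lemma ctends_neq0 f l : l != 0 -> ctends F f l -> \forall x \near F, f x != 0.
Proof.
rewrite -cabs_gt0 => l0 fl; apply: filterS (fl _ l0) => x.
by apply: contraTneq => ->; rewrite sub0r cabsN ltxx.
Qed.

Lemma ctends_unique {PF : ProperFilter F} f l m : ctends F f l -> ctends F f m -> l = m.
Proof.
move=> fl fm; apply/eqP; rewrite -subr_eq0 -cabs_eq0.
rewrite eq_le cabs_ge0 andbT leNgt; apply/negP => lm.
have e0 : 0 < cabs (l - m) / 2 by rewrite divr_gt0.
have [x [h1 h2]] := @filter_ex _ F PF _ (filterI (fl _ e0) (fm _ e0)).
have := cabs_dist_triangle l (f x) m; rewrite leNgt => /negP; apply.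
by rewrite [ltRHS]splitr ltrD // cabs_distC.
Qed.

End Tends.

Lemma ctends_comp X (F : set_system X) {FF : Filter F} (S : set C) (f : X -> C) (g : C -> C) t :
  (\forall x \near F, S (f x)) -> ctends F f t ->
  ctends (cnear S t) g (g t) -> ctends F (fun x => g (f x)) (g t).
Proof.
move=> Sf ft gt e e0; have [d d0 gd] := gt _ e0.
by apply: filterS2 Sf (ft _ d0) => x; exact: gd.
Qed.

Lemma ctends_id S t : ctends (cnear S t) id t.
Proof. by move=> e e0; exists e. Qed.

Lemma cnear_sub (S S' : set C) t : S `<=` S' -> cnear S' t `<=` cnear S t.
Proof. by move=> SS P [d d0 h]; exists d => // z /SS; exact: h. Qed.

Definition odisk : set C := [set z | cabs z < 1].

Lemma odisk_approx t e : cabs t <= 1 -> 0 < e -> exists2 z, odisk z & cabs (z - t) < e.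
Proof.
move=> t1 e0; pose r := Num.min (2^-1 : R) (e / 2).
have r0 : 0 < r by rewrite lt_min invr_gt0 ltr0n /= divr_gt0.
have r1 : r <= 2^-1 by rewrite ge_min lexx.
have re : r <= e / 2 by rewrite ge_min lexx orbT.
exists ((1 - r)%:C%C * t).
  rewrite /odisk /= cabs_realM; last by rewrite subr_ge0; lra.
  by have := cabs_ge0 t; nra.
rewrite (_ : _ - t = (- r)%:C%C * t); last by rewrite rmorphN rmorphB rmorph1 /=; ring.
by rewrite cabsM cabs_real normrN ger0_norm ?ltW //; have := cabs_ge0 t; nra.
Qed.

Lemma cnear_odisk_proper t : cabs t <= 1 -> ProperFilter (cnear odisk t).
Proof.
move=> t1; apply: Build_ProperFilter => // -[d d0] H.
by have [z zD zt] := odisk_approx t1 d0; exact: (H z).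
Qed.

End Limits.

(** * Continuity of the moments and of k at regular points *)

Section ResolventContinuity.
Variables (R : realType) (nu : probability (R * R)%type R).
Hypothesis nuT : prob_on_T nu.
Local Notation C := R[i].
Local Notation cabs := (@fm_cabs R).
Local Notation toC := (@fm_toC R).
Implicit Types z w t : C.

Lemma regular_near t : regular nu t -> \forall z \near cnear setT t, regular nu z.
Proof.
case=> c c0 tc; exists c => // z _ zt; exists (c - cabs (z - t)); first by rewrite subr_gt0.
exact: away_near.
Qed.

(** Rests on the resolvent identity X_z - X_t = (z - t) s X_z X_t; for |z - t| < c / 2 half of the
    gap c at t survives at z, so both resolvents are bounded. *)
Lemma rsv_lipschitz t : regular nu t -> exists d M : R, [/\ 0 < d, 0 < M,
  (forall z, cabs (z - t) < d -> regular nu z /\ {ae nu, forall s, cabs (rsv z s) <= M}) &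
  (forall z, cabs (z - t) < d ->
     {ae nu, forall s, cabs (rsv z s - rsv t s) <= M * cabs (z - t)})].
Proof.
move=> rt; have [c c0 tc] := rt.
have c2 : 0 < c / 2 by rewrite divr_gt0.
have zc z : cabs (z - t) < c / 2 -> away nu z (c / 2).
  by move=> zt; apply: away_le (away_near nuT z tc); lra.
have rz z : cabs (z - t) < c / 2 -> regular nu z by move=> /zc; exists (c / 2).
(* The first summand bounds |X_z|, the second is the Lipschitz constant; the sum serves as both. *)
pose M := (c / 2)^-1 + (c / 2)^-1 * c^-1.
have ci : 0 < c^-1 by rewrite invr_gt0.
have c2i : 0 < (c / 2)^-1 by rewrite invr_gt0.
have ae_le x e : 0 < e -> away nu x e -> {ae nu, forall s, cabs (rsv x s) <= e^-1}.
  move=> e0; apply: filterS => s es; rewrite /rsv cabsV lef_pV2 ?posrE //.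
  exact: lt_le_trans es.
exists (c / 2), M; split => //; first by rewrite /M; nra.
- move=> z zt; split; first exact: rz.
  have h := ae_le _ _ c2 (zc _ zt).
  apply: filterS h => s; move/le_trans; apply.
  by rewrite /M lerDl mulr_ge0 // ltW.
- move=> z zt; have h1 := ae_le _ _ c2 (zc _ zt); have h2 := ae_le _ _ c0 tc.
  have h := aeI (rsvK (rz _ zt)) (rsvK rt).
  have h12 := aeI h1 h2.
  have hu := ae_unit nuT; apply: filterS3 h h12 hu => s [zs ts] [xz xt] s1.
  have -> : rsv z s - rsv t s = (z - t) * toC s * rsv z s * rsv t s.
    rewrite -[in LHS](mul1r (rsv t s)) -{1}zs -[in LHS](mulr1 (rsv z s)) -{1}ts; ring.
  rewrite !cabsM s1 mulr1 -mulrA mulrC; apply: ler_wpM2r; first exact: cabs_ge0.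
  apply: (@le_trans _ _ ((c / 2)^-1 * c^-1)); first by rewrite ler_pM ?cabs_ge0.
  by rewrite /M lerDr ltW.
Qed.

Lemma mrsv_cvg t : regular nu t -> ctends (cnear setT t) (mrsv nu) (mrsv nu t).
Proof.
move=> rt; have [d [M [d0 M0 h1 h2]]] := rsv_lipschitz rt => e e0.
exists (Num.min d (e / M)); first by rewrite lt_min d0 divr_gt0.
move=> z _; rewrite lt_min => /andP[zd ze]; have [rz _] := h1 _ zd.
rewrite /mrsv -cintB; [|exact: cbounded_rsv..].
apply: le_lt_trans (cabs_cint_le _ (h2 _ zd)) _.
  by apply: cboundedB; exact: cbounded_rsv.
by rewrite mulrC -ltr_pdivlMr.
Qed.

(** Joint continuity in two variables, because injectivity of w1 is tested on pairs of distinct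
    points. *)
Lemma grsv_near t e : regular nu t -> 0 < e -> exists2 d : R, 0 < d &
  forall z w, cabs (z - t) < d -> cabs (w - t) < d ->
    cabs (grsv nu z w - grsv nu t t) < e.
Proof.
move=> rt e0; have [d [M [d0 M0 h1 h2]]] := rsv_lipschitz rt.
have MM : 0 < 2 * M * M by rewrite !mulr_gt0.
exists (Num.min d (e / (2 * M * M))); first by rewrite lt_min d0 divr_gt0.
move=> z w; rewrite !lt_min => /andP[zd ze] /andP[wd we].
have [rz _] := h1 _ zd; have [rw bw] := h1 _ wd.
have [_ bt] : regular nu t /\ {ae nu, forall s, cabs (rsv t s) <= M}.
  by apply: h1; rewrite subrr cabs0.
have tt_ := cbounded_grsv nuT rt rt; have zw := cbounded_grsv nuT rz rw.
rewrite /grsv -cintB //.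
apply: (@le_lt_trans _ _ (M * cabs (z - t) * M + M * (M * cabs (w - t)))).
  apply: cabs_cint_le; first exact: cboundedB.
  have bwt := aeI bw bt; apply: filterS3 bwt (h2 _ zd) (h2 _ wd) => s [ws ts] zs wts.
  have -> : rsv z s * (rsv w s)^*%C - rsv t s * (rsv t s)^*%C =
    (rsv z s - rsv t s) * (rsv w s)^*%C + rsv t s * (rsv w s - rsv t s)^*%C.
    by rewrite conjcD conjcN; ring.
  rewrite (le_trans (cabsD _ _)) // !cabsM !cabs_conj; apply: lerD.
  - by rewrite ler_pM ?cabs_ge0.
  - by rewrite ler_pM ?cabs_ge0.
move: ze we; rewrite !ltr_pdivlMr // => ze we; nra.
Qed.

Lemma nrsv_cvg t : regular nu t -> nrsv nu z @[z --> cnear setT t] --> nrsv nu t.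
Proof.
move=> rt; apply/cvgrPdist_lt => e e0; have [d d0 h] := grsv_near rt e0.
exists d => // z _ zt; apply: le_lt_trans (h _ _ zt zt).
by rewrite -cReN -cReD cabs_distC normr_Re_le.
Qed.

Lemma brsv_mrsv z : regular nu z -> z != 0 -> brsv nu z = (mrsv nu z - 1) / z.
Proof. by move=> rz z0; rewrite mrsv_brsv // addrC addKr mulrC mulKf. Qed.

Lemma brsv_cvg t : regular nu t -> t != 0 -> ctends (cnear setT t) (brsv nu) (brsv nu t).
Proof.
move=> rt t0; rewrite brsv_mrsv //.
have h : ctends (cnear setT t) (fun z => (mrsv nu z - 1) / z) ((mrsv nu t - 1) / t).
  apply: ctendsM; first by apply: ctendsB; [exact: mrsv_cvg|exact: ctends_cst].
  by apply: ctendsV => //; exact: ctends_id.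
have z0 := ctends_neq0 t0 (@ctends_id _ setT t).
move=> e e0; near=> z; rewrite brsv_mrsv; first by near: z; exact: h.
- by near: z; exact: regular_near.
- by near: z; exact: z0.
Unshelve. all: by end_near. Qed.

Lemma kfun_cvg t : regular nu t -> cabs t = 1 ->
  kfun nu z @[z --> cnear setT t] --> kfun nu t.
Proof.
move=> rt t1; rewrite kfun_nrsv; under eq_fun do rewrite kfun_nrsv.
have sq f l : ctends (cnear setT t) f l -> cabs (f x) ^+ 2 @[x --> cnear setT t] --> cabs l ^+ 2.
  by move=> fl; rewrite expr2; under eq_fun do rewrite expr2; apply: cvgM; exact: ctends_cabs.
apply: cvgM; first by apply: cvgB; [exact: nrsv_cvg|apply/sq/brsv_cvg => //; exact: cabs1_neq0].
apply: cvgV; last exact/sq/mrsv_cvg.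
by rewrite expf_neq0 // cabs_eq0 mrsv_neq0 // t1.
Qed.

End ResolventContinuity.

(** * Identities at points of the circle *)

Section UnitCircle.
Variables (R : realType) (nu : probability (R * R)%type R).
Hypothesis nuT : prob_on_T nu.
Local Notation C := R[i].
Local Notation cabs := (@fm_cabs R).
Local Notation toC := (@fm_toC R).
Variable t : C.
Hypothesis tC : fm_Cset nu t.

Let t1 : cabs t = 1. Proof. by case: tC. Qed.
Let rt : regular nu t. Proof. exact: regular_Cset. Qed.

Lemma hfun_unit : cabs (hfun nu t) = 1.
Proof.
apply/eqP; rewrite -(@eqrXn2 _ 2) ?cabs_ge0 // expr1n eq_sym -subr_eq0.
by rewrite hfun_cabs ?t1 // expr1n subrr mul0r.
Qed.

Lemma eta_unit : cabs (fm_eta nu t) = 1.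
Proof. by rewrite eta_hfun ?t1 // cabsM t1 hfun_unit mulr1. Qed.

Lemma mrsv_conj : (mrsv nu t)^*%C = 1 - mrsv nu t.
Proof.
have := grsvE nuT rt rt; rewrite mul_conjc t1 expr1n subrr mul0r => /eqP.
by rewrite eq_sym subr_eq0 addrC => /eqP <-; rewrite addrK.
Qed.

Lemma cabs_psi : cabs (fm_psi nu t) = cabs (mrsv nu t).
Proof.
rewrite psi_mrsv // -[in RHS]cabs_conj mrsv_conj cabs_distC //.
Qed.

(** On the circle conj(X_t) = 1 - X_t, so X_t^2 = X_t - |X_t|^2 and the number inside the modulus of
    [fm_Vfun] is -(nrsv - |mrsv|^2). Since |brsv| = |mrsv| = |psi| there, this is the numerator of
    [kfun] up to sign. *)
Lemma Vfun_kfun : fm_Vfun nu t = kfun nu t * cabs (fm_psi nu t * (fm_psi nu t + 1)).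
Proof.
have a0 : cabs (mrsv nu t) != 0 by rewrite cabs_eq0 mrsv_neq0 // t1.
have -> : fm_psi nu t + 1 = mrsv nu t by rewrite psi_mrsv // subrK.
rewrite cabsM cabs_psi -expr2 kfun_nrsv divfK ?expf_neq0 //.
have -> : cabs (brsv nu t) = cabs (mrsv nu t).
  rewrite -cabs_psi psi_mrsv // mrsv_brsv // addrC addKr cabsM t1 mul1r //.
have br := cbounded_rsv nuT rt; have bg := cbounded_grsv nuT rt rt.
rewrite /fm_Vfun.
have -> : fm_cint nu (fun s => 1 / (1 - t * toC s)) = mrsv nu t.
  by congr fm_cint; apply/funext => s; rewrite div1r.
have -> : fm_cint nu (fun s => 1 / (1 - t * toC s) ^+ 2) = mrsv nu t - grsv nu t t.
  rewrite /mrsv /grsv -cintB //; apply: cint_ae_eq; [|exact: cboundedB|].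
    rewrite (_ : (fun _ => _) = fun s => rsv t s ^+ 2); first exact: cboundedX.
    by apply/funext => s; rewrite div1r -exprVn.
  apply: filterS2 (rsvK rt) (ae_unit nuT) => s ts s1; rewrite div1r -exprVn -/(rsv t s).
  have n0 : 1 - t * toC s != 0.
    by apply: contraTneq (oner_neq0 C) => e0; rewrite -ts e0 mul0r eqxx.
  have uu : t * toC s * (t * toC s)^*%C = 1 by rewrite mul_conjc cabsM t1 s1 mulr1 expr1n.
  have tsc : (1 - (t * toC s)^*%C) * (rsv t s)^*%C = 1.
    by rewrite -{1}(conjc1 R) -conjcN -conjcD -conjcM ts conjc1.
  have -> : (rsv t s)^*%C = 1 - rsv t s.
    apply: (mulfI n0); rewrite mulrBr ts.
    have -> : (1 - t * toC s) * (rsv t s)^*%C = - (t * toC s * ((1 - (t * toC s)^*%C) * (rsv t s)^*%C)).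
      by rewrite !mulrBl mulrBr mulrA mulrA uu; ring.
    by rewrite tsc; ring.
  by ring.
have -> : mrsv nu t - grsv nu t t - mrsv nu t ^+ 2 =
    (- (nrsv nu t - cabs (mrsv nu t) ^+ 2))%:C%C.
  rewrite rmorphN rmorphB /= -mul_conjc mrsv_conj grsvR //; ring.
by rewrite cabs_real normrN ger0_norm // subr_ge0 nrsv_ge.
Qed.

End UnitCircle.

(** * Moments of a product of free elements *)

Section FreeMoments.
Variables (R : realType) (A : unitAlgType R[i]) (phi : A -> R[i]) (x1 x2 : A).
Hypothesis phiD : forall u v, phi (u + v) = phi u + phi v.
Hypothesis phiZ : forall (c : R[i]) u, phi (c *: u) = c * phi u.
Hypothesis phi1 : phi 1 = 1.
Hypothesis free12 : fm_free_pair phi x1 x2.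
Implicit Types (b : bool) (s : seq A).

Let gen b := if b then x1 else x2.

Fixpoint alternating b s : Prop :=
  if s is u :: s' then [/\ fm_in_laurent (gen b) u, phi u = 0 & alternating (~~ b) s']
  else True.

Lemma alternating_nth b s k : alternating b s -> (k < size s)%N ->
  fm_in_laurent (gen (b (+) odd k)) (nth 0 s k) /\ phi (nth 0 s k) = 0.
Proof.
elim: s b k => [|u s ih] b [|k] //= [h1 h2 h3] ks; first by rewrite addbF.
by have := ih _ k h3 ks; rewrite addNb addbN.
Qed.

Lemma phi_alternating b s : s != [::] -> alternating b s -> phi (\prod_(u <- s) u) = 0.
Proof.
case: s => // u s _ h; rewrite (big_nth 0) /=.
apply: (free12 (idx := fun k => b (+) odd k)) => [k _|k ks].
- by rewrite /= addbN; case: (b (+) odd k).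
- exact: (@alternating_nth b (u :: s) k h).
Qed.

Lemma laurentX x n : fm_in_laurent x (x ^+ n : A).
Proof. by exists [:: (n%:Z, 1)]; rewrite big_seq1 scale1r. Qed.

Lemma laurent_centered x (m : R[i]) : fm_in_laurent x (x - m *: 1 : A).
Proof.
by exists [:: (1%:Z, 1); (0%:Z, - m)]; rewrite !big_cons big_nil addr0 scale1r scaleNr.
Qed.

Variable b : bool.
Let x := gen b.
Let y := gen (~~ b).
Let a := x - phi x *: 1.

Lemma phi_centered : phi a = 0.
Proof. by rewrite /a phiD -scaleNr phiZ phi1 mulr1 subrr. Qed.

Lemma phi_split (u v : A) : phi (u * x * v) = phi x * phi (u * v) + phi (u * (a * v)).
Proof.
have e : x = phi x *: 1 + a by rewrite /a addrC subrK.
by rewrite {1}e mulrDr mulrDl phiD -scalerAr -scalerAl phiZ mulr1 -mulrA.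
Qed.

Variable n : nat.
Hypothesis y0 : forall q, (0 < q < n)%N -> phi (y ^+ q) = 0.

(** Write the x just before y^p as phi x + a. The scalar part merges the neighbouring powers into
    y^(p+1), the centred part starts a longer alternating tail. Both leave a smaller j, and p + j <
    n keeps every power of y centred. *)
Lemma phi_word_eq0 j p s : (0 < p)%N -> (p + j < n)%N -> s != [::] -> alternating b s ->
  phi ((x * y) ^+ j * x * (y ^+ p * \prod_(u <- s) u)) = 0.
Proof.
have altc q s' : (0 < q)%N -> (q < n)%N -> alternating b s' ->
    alternating (~~ b) (y ^+ q :: s').
  by move=> q0 qn h; split; [exact: laurentX|by apply: y0; rewrite q0|rewrite negbK].
have alta s' : alternating (~~ b) s' -> alternating b (a :: s').
  by move=> h; split; [exact: laurent_centered|exact: phi_centered|].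
elim: j p s => [|j ih] p s p0 pjn s0 hs; rewrite phi_split.
  rewrite addn0 in pjn; rewrite expr0 !mul1r.
  have h := altc p s p0 pjn hs.
  have e1 : y ^+ p * \prod_(u <- s) u = \prod_(u <- y ^+ p :: s) u by rewrite big_cons.
  have e2 : a * (y ^+ p * \prod_(u <- s) u) = \prod_(u <- a :: y ^+ p :: s) u by rewrite !big_cons.
  by rewrite e1 (phi_alternating _ h) // -e1 e2 (phi_alternating _ (alta _ h)) // mulr0 addr0.
have pn : (p < n)%N by apply: leq_ltn_trans pjn; rewrite leq_addr.
have e1 : (x * y) ^+ j.+1 * (y ^+ p * \prod_(u <- s) u) =
    (x * y) ^+ j * x * (y ^+ p.+1 * \prod_(u <- s) u).
  by rewrite exprSr exprS !mulrA.
have e2 : (x * y) ^+ j.+1 * (a * (y ^+ p * \prod_(u <- s) u)) =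
    (x * y) ^+ j * x * (y ^+ 1 * \prod_(u <- a :: y ^+ p :: s) u).
  by rewrite exprSr !big_cons expr1 !mulrA.
rewrite e1 ih //; last by rewrite addSn -addnS.
rewrite e2 ih ?mulr0 ?addr0 //; last exact/alta/altc.
by apply: leq_ltn_trans pjn; rewrite add1n leq_addl.
Qed.

(** Each splitting of x contributes a factor phi x and raises the power of y by one, until y^n
    remains. The centred parts vanish by [phi_word_eq0], the last one directly by freeness. *)
Lemma phi_word j p : (0 < p)%N -> (p + j)%N = n ->
  phi ((x * y) ^+ j * x * y ^+ p) = phi x ^+ j.+1 * phi (y ^+ n).
Proof.
elim: j p => [|j ih] p p0 pjn; rewrite phi_split.
  rewrite addn0 in pjn; rewrite pjn !mul1r expr1 [phi (a * _)](_ : _ = 0) ?addr0 //.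
  pose yc := y ^+ n - phi (y ^+ n) *: 1.
  have yc0 : phi yc = 0 by rewrite phiD -scaleNr phiZ phi1 mulr1 subrr.
  have -> : a * y ^+ n = phi (y ^+ n) *: a + \prod_(u <- [:: a; yc]) u.
    by rewrite !big_cons big_nil mulr1 /yc mulrBr -scalerAr mulr1 addrC subrK.
  rewrite phiD phiZ phi_centered mulr0 add0r (@phi_alternating b) //; split.
  - exact: laurent_centered.
  - exact: phi_centered.
  - split=> //; exists [:: (n%:Z, 1); (0%:Z, - phi (y ^+ n))].
    by rewrite !big_cons big_nil addr0 scale1r scaleNr.
have pn : (p < n)%N by rewrite -pjn -addSnnS leq_addr.
have e1 : (x * y) ^+ j.+1 * y ^+ p = (x * y) ^+ j * x * y ^+ p.+1.
  by rewrite exprSr exprS !mulrA.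
have e2 : (x * y) ^+ j.+1 * (a * y ^+ p) =
    (x * y) ^+ j * x * (y ^+ 1 * \prod_(u <- [:: a; y ^+ p]) u).
  by rewrite exprSr !big_cons big_nil expr1 mulr1 !mulrA.
rewrite e1 ih ?e2 ?phi_word_eq0 //; last by rewrite addSnnS.
- by rewrite addr0 mulrA -exprS.
- by rewrite add1n -pjn -[X in (X < _)%N]add0n ltn_add2r.
- split; [exact: laurent_centered|exact: phi_centered|split => //; first exact: laurentX].
  by rewrite y0 // p0.
Qed.

(** Meant for induction on n: if phi x is nonzero and the moments of x y vanish, it kills the
    moments of y one after the other. *)
Lemma free_moment : (0 < n)%N -> phi ((x * y) ^+ n) = phi x ^+ n * phi (y ^+ n).
Proof. by case: n y0 phi_word => // m _ h _; rewrite -(h m 1%N) // exprSr expr1 mulrA. Qed.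

End FreeMoments.

(* If mu has the moments of Haar measure, the subordination equations are satisfied by
   w1 = w2 = 0 whatever mu1 and mu2 are; freeness is what excludes this degenerate solution. *)
Lemma free_conv_moments (R : realType) (mu1 mu2 mu : probability (R * R)%type R) :
  free_mult_conv mu1 mu2 mu ->
  (forall n, (0 < n)%N -> fm_cint mu (fun s => fm_toC s ^+ n) = 0) ->
  [\/ fm_cint mu1 (@fm_toC R) = 0 /\ fm_cint mu2 (@fm_toC R) = 0,
      (forall n, (0 < n)%N -> fm_cint mu1 (fun s => fm_toC s ^+ n) = 0) |
      (forall n, (0 < n)%N -> fm_cint mu2 (fun s => fm_toC s ^+ n) = 0)].
Proof.
move=> [A [phi [x1 [x2 [phiD phiZ phi1 phiC [_ _ fr d1 [d2 d]]]]]]] mu0.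
have m12 n : (0 < n)%N -> phi ((x1 * x2) ^+ n) = 0.
  by move=> n0; have := d n; rewrite -exprnP => ->; exact: mu0.
(* Traciality: moving the final x1 to the front turns a power of x2 x1 into the same power of x1
   x2. *)
have m21 n : (0 < n)%N -> phi ((x2 * x1) ^+ n) = 0.
  case: n => // n _; rewrite exprSr mulrA phiC mulrA.
  have -> : x1 * (x2 * x1) ^+ n * x2 = (x1 * x2) ^+ n.+1.
    by elim: n => [|n ih]; rewrite ?mulr1 // [in LHS]exprSr !mulrA ih [in RHS]exprSr !mulrA.
  exact: m12.
have red b : phi (if b then x1 else x2) != 0 ->
    (forall n, (0 < n)%N -> phi (((if b then x1 else x2) * (if ~~ b then x1 else x2)) ^+ n) = 0) ->
    forall n, (0 < n)%N -> phi ((if ~~ b then x1 else x2) ^+ n) = 0.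
  move=> xb xy; elim/ltn_ind => n ih n0.
  have := @free_moment R A phi x1 x2 phiD phiZ phi1 fr b n.
  rewrite xy // => /(_ _ n0) h; have /eqP := h (fun q => fun hq => ih q (proj2 (andP hq)) (proj1 (andP hq))).
  by rewrite eq_sym mulf_eq0 expf_eq0 (negbTE xb) andbF => /eqP.
have e1 : fm_cint mu1 (@fm_toC R) = phi x1 by rewrite -[x1]expr1 -[_ ^+ 1]/(x1 ^ 1%:Z) d1.
have e2 : fm_cint mu2 (@fm_toC R) = phi x2 by rewrite -[x2]expr1 -[_ ^+ 1]/(x2 ^ 1%:Z) d2.
have [p1|p1] := eqVneq (phi x1) 0; last first.
  by apply: Or33 => n n0; rewrite -[RHS](red true p1 m12 n n0); rewrite exprnP d2.
have [p2|p2] := eqVneq (phi x2) 0; first by apply: Or31; rewrite e1 e2.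
by apply: Or32 => n n0; rewrite -[RHS](red false p2 m21 n n0) exprnP d1.
Qed.

(** * Rational coordinates on the circle *)

Section CayleyArc.
Variable R : realType.
Local Notation C := R[i].
Local Notation cabs := (@fm_cabs R).

(** For y = tan(theta / 2) this is exp(i theta): a 2-Lipschitz parametrisation of the circle without
    -1 that avoids trigonometry. *)
Definition cayley (y : R) : C := (1 +i* y)%C / (1 -i* y)%C.

Lemma cayley_den (y : R) : 1 <= cabs (1 -i* y)%C.
Proof.
rewrite -(@ler_sqr _ 1) ?nnegrE ?cabs_ge0 // expr1n cabs_sqr /=.
by rewrite expr1n lerDl sqr_ge0.
Qed.

Lemma cayley_den_neq0 (y : R) : (1 -i* y)%C != 0 :> C.
Proof. by rewrite -cabs_gt0 (lt_le_trans ltr01) // cayley_den. Qed.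

Lemma cayley_unit y : cabs (cayley y) = 1.
Proof.
rewrite /cayley cabs_div (_ : (1 +i* y)%C = ((1 -i* y)%C : C)^*%C); last by rewrite /= opprK.
by rewrite cabs_conj divff // cabs_eq0 cayley_den_neq0.
Qed.

Lemma cayley0 : cayley 0 = 1.
Proof. by rewrite /cayley oppr0 divff // -[_ != 0]/((1 : C) != 0) oner_neq0. Qed.

Lemma cayleyN y : cayley (- y) = (cayley y)^-1.
Proof. by rewrite /cayley opprK invf_div. Qed.

Lemma cayley_lipschitz x y : cabs (cayley x - cayley y) <= 2 * `|x - y|.
Proof.
have nx := cayley_den_neq0 x; have ny := cayley_den_neq0 y.
have -> : cayley x - cayley y = (0 +i* (2 * (x - y)))%C / ((1 -i* x)%C * (1 -i* y)%C).
  apply: (mulIf (mulf_neq0 nx ny)); rewrite divfK ?mulf_neq0 //.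
  have -> : (cayley x - cayley y) * ((1 -i* x)%C * (1 -i* y)%C) =
      (1 +i* x)%C * (1 -i* y)%C - (1 +i* y)%C * (1 -i* x)%C.
    by rewrite /cayley; field; rewrite nx ny.
  by apply: complex_eq; rewrite /=; ring.
rewrite cabs_div cabsM.
have -> : cabs (0 +i* (2 * (x - y)))%C = 2 * `|x - y|.
  by rewrite /fm_cabs /= expr0n add0r sqrtr_sqr normrM ger0_norm.
rewrite ler_pdivrMr; last by rewrite mulr_gt0 // cabs_gt0.
by rewrite ler_peMr ?mulr_ge0 // mulr_ege1 // cayley_den.
Qed.

Lemma cayley_surj w : cabs w = 1 -> cabs (w - 1) <= 1 ->
  exists2 y : R, `|y| <= cabs (w - 1) & w = cayley y.
Proof.
case: w => u v w1 d1.
have uv : u ^+ 2 + v ^+ 2 = 1 by have := cabs_sqr (u +i* v)%C; rewrite w1 expr1n /= => ->.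
have dd : cabs ((u +i* v)%C - 1) ^+ 2 = 2 - 2 * u.
  by rewrite cabs_sqr /= subr0; move: uv; nra.
have u2 : 2^-1 <= u by have := cabs_ge0 ((u +i* v)%C - 1); nra.
have u1 : 0 < 1 + u by lra.
(* The tangent of the half angle; |w - 1| <= 1 gives u >= 1/2, so the denominator exceeds 1. *)
exists (v / (1 + u)).
  rewrite normrM normfV (ger0_norm (ltW u1)); apply: (@le_trans _ _ `|v|).
    by rewrite ler_pdivrMr // ler_peMr //; lra.
  by have := normr_Im_le ((u +i* v)%C - 1); rewrite /= subr0.
apply: (mulIf (cayley_den_neq0 (v / (1 + u)))); rewrite /cayley divfK ?cayley_den_neq0 //.
have u1' : 1 + u != 0 by rewrite gt_eqF.
apply: complex_eq; rewrite /=.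
- by apply: (mulIf u1'); rewrite mulrBl mulrN mulNr opprK mulr1 -!mulrA mulVf // mulr1 mul1r; move: uv; rewrite !expr2; nra.
- by apply: (mulIf u1'); rewrite mulrDl mulrN mulNr mulr1 -!mulrA mulVf // !mulr1; ring.
Qed.

End CayleyArc.

(** * From bounded second moments to gaps in the support *)

Section MassBound.
Variables (R : realType) (nu : probability (R * R)%type R).
Hypothesis nuT : prob_on_T nu.
Local Notation C := R[i].
Local Notation cabs := (@fm_cabs R).
Local Notation toC := (@fm_toC R).

(** Chebyshev's inequality: for unimodular s in the ball |1 - z s| <= 2 r, hence |X_z|^2 >= 1 / (4
    r^2). *)
Lemma eball_mass (w z : C) (r : R) : cabs w = 1 -> 0 < r -> cabs z < 1 -> cabs (z - w) < r ->
  (nu (fm_eball (fm_fromC w^-1%R) r) <= (4 * r ^+ 2 * nrsv nu z)%:E)%E.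
Proof.
move=> w1 r0 z1 zw; have rz := regular_disk nuT z1; set B := fm_eball _ _.
have mB : measurable B by exact: measurable_eball.
have bg := cbounded_grsv nuT rz rz.
have bB : ess_bounded nu (\1_B : R * R -> R).
  split; first exact: measurable_indic.
  by exists 1; apply: aeW => s; rewrite indicE; case: (_ \in _); rewrite ?normr1 ?normr0.
have nuB : fine (\int[nu]_s (\1_B s)%:E) = fine (nu B) by rewrite integral_indic // setIT.
rewrite -[nu B]fineK ?fin_num_measure // lee_fin -nuB -rintZ; last by case: bg.
apply: rint_ae_le => //; first by apply: ess_boundedM; [exact: ess_bounded_cst|case: bg].
apply: filterS2 (rsvK rz) (ae_unit nuT) => s zs s1.
rewrite mul_conjc indicE; have [|_] := boolP (s \in B); last first.
  by rewrite /= mulr_ge0 ?sqr_ge0 // mulr_ge0 ?sqr_ge0.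
rewrite inE => /(eballE _ _ r0) sw /=.
have w0 := cabs1_neq0 w1.
have d : cabs (1 - z * toC s) <= 2 * r.
  have -> : 1 - z * toC s = - w * (toC s - w^-1) - (z - w) * toC s.
    by rewrite mulrBr !mulNr divff // mulrBl; ring.
  apply: le_trans (cabsB _ _) _; rewrite !cabsM cabsN w1 s1 mul1r mulr1.
  by rewrite mulr_natl mulr2n lerD // ltW.
have e : cabs (1 - z * toC s) * cabs (rsv z s) = 1 by rewrite -cabsM zs cabs1.
have h : 1 <= 2 * r * cabs (rsv z s) by rewrite -{1}e ler_wpM2r // cabs_ge0.
have -> : 4 * r ^+ 2 * cabs (rsv z s) ^+ 2 = (2 * r * cabs (rsv z s)) ^+ 2 by ring.
by rewrite exprn_ege1.
Qed.

(* Each bisection of the arc improves a mass bound quadratic in the length by a factor 2. *)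
Lemma arc_cover (t : C) (del Q : R) : cabs t = 1 -> 0 <= Q ->
  (forall w, cabs w = 1 -> cabs (w - t) < del -> forall e : R, 0 < e ->
     exists z, [/\ cabs z < 1, cabs (z - w) < e & nrsv nu z <= Q]) ->
  forall (n : nat) (x l : R), 0 < l -> (forall y, x <= y <= x + l -> 2 * `|y| < del) ->
  exists A, [/\ measurable A,
    (forall s y, x <= y <= x + l -> toC s = t^-1 * cayley y -> A s) &
    (nu A <= (36 * Q * l ^+ 2 / 2 ^+ n)%:E)%E].
Proof.
move=> t1 Q0 bnd; have t0 := cabs1_neq0 t1; elim=> [|n ih] x l l0 xl.
  pose w := t * cayley (- x).
  have w1 : cabs w = 1 by rewrite cabsM t1 cayley_unit mulr1.
  have wt : cabs (w - t) < del.
    rewrite -[X in _ - X]mulr1 -mulrBr cabsM t1 mul1r -(cayley0 R).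
    apply: le_lt_trans (cayley_lipschitz _ _) _; rewrite subr0 normrN xl //.
    by rewrite lexx lerDl ltW.
  have l3 : 0 < 3 * l by rewrite mulr_gt0.
  have [z [z1 zw nz]] := bnd w w1 wt _ l3.
  exists (fm_eball (fm_fromC w^-1) (3 * l)); split; first exact: measurable_eball.
    move=> s y xy sy; apply/(eballE _ _ l3); rewrite sy.
    rewrite /w invfM cayleyN invrK -mulrBr cabsM cabsV t1 invr1 mul1r.
    apply: le_lt_trans (cayley_lipschitz _ _) _.
    by move/andP: xy => [xy yx]; rewrite ger0_norm ?subr_ge0 //; lra.
  apply: le_trans (eball_mass w1 l3 z1 zw) _; rewrite lee_fin expr0 divr1.
  by rewrite [leLHS](_ : _ = 36 * nrsv nu z * l ^+ 2); [rewrite ler_wpM2r ?sqr_ge0 // ler_wpM2l|ring].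
have l2 : 0 < l / 2 by rewrite divr_gt0.
have [|A [mA sA nA]] := ih x (l / 2) l2.
  by move=> y /andP[xy yx]; apply: xl; rewrite xy /=; lra.
have [|B [mB sB nB]] := ih (x + l / 2) (l / 2) l2.
  by move=> y /andP[xy yx]; apply: xl; apply/andP; split; lra.
exists (A `|` B); split; first exact: measurableU.
  move=> s y /andP[xy yx] e; have [yl|ly] := leP y (x + l / 2).
  - by left; apply: (sA s y) => //; rewrite xy.
  - by right; apply: (sB s y) => //; apply/andP; split; lra.
apply: le_trans (measureU2 nu mA mB) _.
apply: le_trans (leeD nA nB) _; rewrite -EFinD lee_fin (exprS 2 n).
have n0 : 2 ^+ n != 0 :> R by rewrite expf_neq0.
by rewrite le_eqVlt; apply/orP; left; apply/eqP; field.
Qed.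

Lemma Cset_of_bound (t : C) (del Q : R) : cabs t = 1 -> 0 < del -> 0 <= Q ->
  (forall w, cabs w = 1 -> cabs (w - t) < del -> forall e : R, 0 < e ->
     exists z, [/\ cabs z < 1, cabs (z - w) < e & nrsv nu z <= Q]) ->
  fm_Cset nu t.
Proof.
move=> t1 d0 Q0 bnd; split => //; have t0 := cabs1_neq0 t1.
pose e := Num.min 1 (del / 4).
have e0 : 0 < e by rewrite lt_min ltr01 divr_gt0.
have e1 : e <= 1 by rewrite ge_min lexx.
have ed : e <= del / 4 by rewrite ge_min lexx orbT.
apply/existsNP; exists e; apply/not_implyP; split => //; apply/negP; rewrite -leNgt.
set B := fm_eball _ _.
have mB : measurable B by exact: measurable_eball.
have nuTc : nu (~` @fm_Tset R) = 0%E.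
  by rewrite probability_setC ?nuT ?subee //; exact: measurable_Tset.
have nB n : (nu B <= (36 * Q * (2 * e) ^+ 2 / 2 ^+ n)%:E)%E.
  have e2 : 0 < 2 * e by rewrite mulr_gt0.
  have [|A [mA sA nA]] := arc_cover t1 Q0 bnd n (x := - e) e2.
    move=> y /andP[y1 y2]; have : `|y| <= e by rewrite ler_norml y1 /=; lra.
    by lra.
  apply: le_trans nA.
  have mTc : measurable (~` @fm_Tset R) by apply: measurableC; exact: measurable_Tset.
  have -> : nu A = (nu A + nu (~` @fm_Tset R))%E by rewrite nuTc adde0.
  apply: le_trans (measureU2 nu mA mTc); apply: le_measure; rewrite ?inE //; first exact: measurableU.
  move=> s /(eballE _ _ e0) sb.
  have [sT|sT] := pselect (@fm_Tset R s); [left|by right].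
  have s1 : cabs (toC s) = 1.
    by apply/eqP; rewrite -(@eqrXn2 _ 2) ?cabs_ge0 // expr1n cabs_sqr; apply/eqP.
  have ts1 : cabs (t * toC s) = 1 by rewrite cabsM t1 s1 mulr1.
  have tsd : cabs (t * toC s - 1) < e.
    rewrite (_ : _ - 1 = t * (toC s - t^-1)); last by rewrite mulrBr divff.
    by rewrite cabsM t1 mul1r.
  have [|y yd ty] := cayley_surj ts1; first exact: le_trans (ltW tsd) e1.
  apply: (sA s y); last by rewrite -ty mulKf.
  have : `|y| <= e by exact: le_trans yd (ltW tsd).
  by rewrite ler_norml => /andP[y1 y2]; rewrite y1 /=; lra.
have nf : nu B \is a fin_num by rewrite fin_num_measure.
rewrite -(fineK nf) lee_fin leNgt; apply/negP => m0.
set m := fine _ in m0; pose K := 36 * Q * (2 * e) ^+ 2.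
have K0 : 0 <= K by apply: mulr_ge0; [exact: mulr_ge0 | exact: sqr_ge0].
have := archi_boundP (divr_ge0 K0 (ltW m0)); set n := Num.bound _ => Kn.
have := nB n; rewrite -(fineK nf) lee_fin leNgt => /negP; apply.
rewrite -/K ltr_pdivrMr ?exprn_gt0 // mulrC -ltr_pdivrMr //.
by apply: lt_le_trans Kn _; rewrite -natrX ler_nat ltnW // ltn_expl.
Qed.

End MassBound.

Lemma geometric_eq0 (R : realType) (z : R[i]) (q B : R) : 0 <= q < 1 ->
  (forall n, (0 < n)%N -> fm_cabs z <= q ^+ n * B) -> z = 0.
Proof.
move=> /andP[q0 q1] h; apply/eqP; rewrite -cabs_eq0 eq_le cabs_ge0 andbT.
have cq : (fun n => q ^+ n * B) @ \oo --> 0.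
  rewrite -(mul0r B); apply: cvgM; last exact: cvg_cst.
  by apply: cvg_expr; rewrite ger0_norm.
rewrite -(cvg_lim _ cq) //; apply: limr_ge; first by apply/cvg_ex; exists 0.
by exists 1%N => // n /= n0; exact: h.
Qed.

Section Taylor.
Variables (R : realType) (nu : probability (R * R)%type R).
Hypothesis nuT : prob_on_T nu.
Local Notation C := R[i].
Local Notation cabs := (@fm_cabs R).
Local Notation toC := (@fm_toC R).
Implicit Types z : C.

Definition trem z1 n z : C := fm_cint nu (fun s => (toC s * rsv z1 s) ^+ n * rsv z s).

Lemma trem_rec z1 n z : cabs z1 < 1 -> cabs z < 1 ->
  trem z1 n z = trem z1 n z1 + (z - z1) * trem z1 n.+1 z.
Proof.
move=> z11 z1'; have r1 := regular_disk nuT z11; have rz := regular_disk nuT z1'.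
have b m w : regular nu w -> cbounded nu (fun s => (toC s * rsv z1 s) ^+ m * rsv w s).
  by move=> rw; apply: cboundedM; [apply/cboundedX/cbounded_brsv|apply: cbounded_rsv].
have bz := cboundedZ (z - z1) (b n.+1 z rz).
rewrite /trem -cintZ; last exact: b.
rewrite -cintD //; last exact: b.
apply: cint_ae_eq; [exact: b|by apply: cboundedD => //; exact: b|].
apply: filterS2 (rsvK rz) (rsvK r1) => s zs z1s.
have : rsv z s * ((1 - z1 * toC s) * rsv z1 s) =
    rsv z1 s * ((1 - z * toC s) * rsv z s) + (z - z1) * (toC s * rsv z1 s) * rsv z s by ring.
by rewrite z1s zs !mulr1 => {1}->; rewrite mulrDr exprS; congr (_ + _); ring.
Qed.

Lemma trem0 z1 z : trem z1 0 z = mrsv nu z.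
Proof. by congr fm_cint; apply/funext => s; rewrite expr0 mul1r. Qed.

Lemma trem_bound z1 n z : cabs z1 < 1 -> cabs z < 1 ->
  cabs (trem z1 n z) <= (1 - cabs z1)^-1 ^+ n * (1 - cabs z)^-1.
Proof.
move=> z11 z1'; have r1 := regular_disk nuT z11; have rz := regular_disk nuT z1'.
have ae_le w : cabs w < 1 -> {ae nu, forall s, cabs (rsv w s) <= (1 - cabs w)^-1}.
  move=> w1; apply: filterS (ae_unit nuT) => s s1.
  have h : 1 - cabs w <= cabs (1 - w * toC s).
    by apply: le_trans (cabs_ge_sub _ _); rewrite cabs1 cabsM s1 mulr1.
  have w1' : 0 < 1 - cabs w by rewrite subr_gt0.
  by rewrite /rsv cabsV lef_pV2 ?posrE // (lt_le_trans w1').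
apply: cabs_cint_le.
  by apply: cboundedM; [apply/cboundedX/cbounded_brsv|apply: cbounded_rsv].
have h1 := ae_le _ z11; have h2 := ae_le _ z1'; have h3 := ae_unit nuT.
apply: filterS3 h1 h2 h3 => s a1 a2 s1.
rewrite cabsM cabsX cabsM s1 mul1r ler_pM ?exprn_ge0 ?cabs_ge0 //.
by rewrite lerXn2r ?nnegrE ?cabs_ge0 // (le_trans (cabs_ge0 _) a1).
Qed.

Lemma mrsv_eq1_disk z1 z : cabs z1 < 1 -> mrsv nu z1 = 1 ->
  (forall n, (0 < n)%N -> trem z1 n z1 = 0) ->
  cabs (z - z1) < 1 - cabs z1 -> cabs z < 1 -> mrsv nu z = 1.
Proof.
move=> z11 m1 c0 zz z1'; apply/eqP; rewrite -subr_eq0; apply/eqP.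
have e n : mrsv nu z - 1 = (z - z1) ^+ n.+1 * trem z1 n.+1 z.
  elim: n => [|n ih]; first by rewrite -(trem0 z1 z) trem_rec // trem0 m1 expr1 addrC addKr.
  by rewrite ih trem_rec // c0 // add0r [in RHS]exprSr mulrA.
have p0 : 0 < 1 - cabs z1 by rewrite subr_gt0.
apply: (@geometric_eq0 _ _ (cabs (z - z1) / (1 - cabs z1)) (1 - cabs z)^-1).
  by rewrite divr_ge0 ?cabs_ge0 ?ltW //= ltr_pdivrMr // mul1r.
move=> [//|n] _; rewrite (e n) cabsM cabsX expr_div_n -mulrA -exprVn.
by rewrite ler_wpM2l ?exprn_ge0 ?cabs_ge0 // trem_bound.
Qed.

Lemma trem_eq0 (u : C) (r1 d : R) : cabs u = 1 -> `|r1| < 1 -> 0 < d ->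
  (forall r, `|r - r1| < d -> `|r| < 1 -> mrsv nu (r%:C%C * u) = 1) ->
  forall n, (0 < n)%N -> trem (r1%:C%C * u) n (r1%:C%C * u) = 0.
Proof.
move=> u1 r11 d0 m1; set z1 := r1%:C%C * u.
have cz (r : R) : cabs (r%:C%C * u) = `|r| by rewrite cabsM cabs_real u1 mulr1.
have z11 : cabs z1 < 1 by rewrite cz.
pose d' := Num.min d ((1 - `|r1|) / 2).
have r1' : 0 < 1 - `|r1| by rewrite subr_gt0.
have d'0 : 0 < d' by rewrite lt_min d0 divr_gt0.
have d'd : d' <= d by rewrite ge_min lexx.
have d'r : d' <= (1 - `|r1|) / 2 by rewrite ge_min lexx orbT.
have near1 e : 0 < e -> e < d' -> [/\ `|(r1 + e) - r1| < d, `|r1 + e| < 1 - (1 - `|r1|) / 2 &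
    `|r1 + e| < 1].
  move=> e0 ed; rewrite addrC addKr ger0_norm ?(ltW e0) //.
  have h : `|r1 + e| < 1 - (1 - `|r1|) / 2.
    by apply: le_lt_trans (ler_normD _ _) _; rewrite (ger0_norm (ltW e0)); lra.
  by split; [exact: lt_le_trans d'd|exact: h|apply: lt_trans h _; lra].
pose B n := (1 - cabs z1)^-1 ^+ n * ((1 - `|r1|) / 2)^-1.
have tb n e : 0 < e -> e < d' -> cabs (trem z1 n ((r1 + e)%:C%C * u)) <= B n.
  move=> e0 ed; have [_ h1 h2] := near1 _ e0 ed.
  apply: le_trans (trem_bound _ z11 _) _; first by rewrite cz.
  rewrite /B ler_wpM2l ?exprn_ge0 ?invr_ge0 ?subr_ge0 ?(ltW z11) // cz.
  by rewrite lef_pV2 ?posrE ?divr_gt0 ?subr_gt0 //; lra.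
have dz e : (r1 + e)%:C%C * u - z1 = e%:C%C * u by rewrite /z1 rmorphD /=; ring.
have dn0 e : 0 < e -> e%:C%C * u != 0.
  move=> e0; apply: mulf_neq0; last exact: cabs1_neq0.
  by rewrite -cabs_gt0 cabs_real normr_gt0 gt_eqF.
suff H n : (forall e, 0 < e -> e < d' -> trem z1 n.+1 ((r1 + e)%:C%C * u) = 0) /\
           ((0 < n)%N -> trem z1 n z1 = 0).
  by move=> n n0; exact: (H n).2.
elim: n => [|n [ih _]].
  split=> // e e0 ed; have [h1 h2 h3] := near1 _ e0 ed.
  have := @trem_rec z1 0 ((r1 + e)%:C%C * u) z11; rewrite cz h3 !trem0 => /(_ isT).
  rewrite m1 // dz m1 ?subrr ?normr0 // => /eqP; rewrite -subr_eq0 opprD addrA subrr sub0r oppr_eq0.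
  by rewrite mulf_eq0 (negbTE (dn0 _ e0)) /= => /eqP.
have c0 : trem z1 n.+1 z1 = 0.
  apply/eqP; rewrite -cabs_eq0 eq_le cabs_ge0 andbT leNgt; apply/negP => c0.
  have B0 : 0 <= B n.+2 by apply: le_trans (tb n.+2 (d' / 2) _ _); rewrite ?cabs_ge0 ?divr_gt0 //; lra.
  have b1 : 0 < B n.+2 + 1 by lra.
  pose e := Num.min (d' / 2) (cabs (trem z1 n.+1 z1) / (B n.+2 + 1)).
  have e0 : 0 < e by rewrite lt_min !divr_gt0.
  have ed : e < d' by apply: (@le_lt_trans _ _ (d' / 2)); [rewrite ge_min lexx|lra].
  have eb : e * (B n.+2 + 1) <= cabs (trem z1 n.+1 z1).
    by rewrite -ler_pdivlMr // ge_min lexx orbT.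
  have [_ _ h3] := near1 _ e0 ed.
  have := @trem_rec z1 n.+1 ((r1 + e)%:C%C * u) z11; rewrite cz h3 ih // dz => /(_ isT) /esym/eqP.
  rewrite addr_eq0 => /eqP ee; move: eb; rewrite ee cabsN !cabsM cabs_real u1 mulr1.
  rewrite (ger0_norm (ltW e0)) ler_pM2l // leNgt => /negP; apply.
  by apply: le_lt_trans (tb _ _ e0 ed) _; lra.
split=> // e e0 ed; have [_ _ h3] := near1 _ e0 ed.
have := @trem_rec z1 n.+1 ((r1 + e)%:C%C * u) z11; rewrite cz h3 ih // dz c0 add0r => /(_ isT) /esym/eqP.
by rewrite mulf_eq0 (negbTE (dn0 _ e0)) /= => /eqP.
Qed.

Lemma trem_origin n : trem 0 n 0 = fm_cint nu (fun s => toC s ^+ n).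
Proof.
by congr fm_cint; apply/funext => s; rewrite /rsv mul0r subr0 invr1 !mulr1.
Qed.

Lemma radial_moments_eq0 (u : C) (d : R) : cabs u = 1 -> 0 < d ->
  (forall r, 1 - d < r < 1 -> `|r| < 1 -> mrsv nu (r%:C%C * u) = 1) ->
  forall n, (0 < n)%N -> fm_cint nu (fun s => toC s ^+ n) = 0.
Proof.
move=> u1 d0.
have [k] : exists k : nat, 1 < d * (3 / 2) ^+ k.
  pose k := Num.bound (2 / d).
  have hk : 2 / d < k%:R by apply: archi_boundP; rewrite divr_ge0 // ltW.
  exists k; move: hk; rewrite ltr_pdivrMr // mulrC => hk.
  suff : k%:R / 2 <= (3 / 2) ^+ k :> R by move=> h; nra.
  elim: k {hk} => [|k ih]; first by rewrite expr0; lra.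
  have : 1 <= (3 / 2) ^+ k :> R by rewrite exprn_ege1 //; lra.
  have -> : k.+1%:R = k%:R + 1 :> R by rewrite natr1.
  by rewrite exprS; lra.
elim: k d d0 => [|k ih] d d0 dk m1.
  rewrite expr0 mulr1 in dk => n n0; rewrite -trem_origin.
  have := @trem_eq0 u 0 (d - 1) u1; rewrite normr0 mul0r subr_gt0 => h.
  apply: h => // r; rewrite subr0 => rd r1; apply: m1 => //.
  by move: rd r1; rewrite !ltr_norml => /andP[a1 a2] /andP[a3 a4]; apply/andP; split; lra.
have [d1|d1] := ltP 1 d.
  move=> n n0; rewrite -trem_origin.
  have := @trem_eq0 u 0 (d - 1) u1; rewrite normr0 mul0r subr_gt0 => h.
  apply: h => // r; rewrite subr0 => rd r1; apply: m1 => //.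
  by move: rd r1; rewrite !ltr_norml => /andP[a1 a2] /andP[a3 a4]; apply/andP; split; lra.
apply: (ih (d * (3 / 2))); [by rewrite mulr_gt0|by rewrite -mulrA -exprS|].
move=> r /andP[r1 r2] r3; pose r0 := 1 - d * (3 / 4).
have r0p : 0 <= r0 by rewrite /r0; lra.
have r0n : `|r0| = r0 by rewrite ger0_norm.
have r01 : `|r0| < 1 by rewrite r0n /r0; lra.
have cz (x : R) : cabs (x%:C%C * u) = `|x| by rewrite cabsM cabs_real u1 mulr1.
apply: (@mrsv_eq1_disk (r0%:C%C * u)); rewrite ?cz //.
- by apply: m1 => //; rewrite /r0; apply/andP; split; lra.
- apply: (@trem_eq0 u r0 (d / 4)) => //; first by rewrite divr_gt0.
  move=> x; rewrite ltr_norml => /andP[x1 x2] x3; apply: m1 => //.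
  by move: x1 x2; rewrite /r0 => x1 x2; apply/andP; split; lra.
- rewrite -mulrBl -rmorphB /= cz r0n ltr_norml /r0; apply/andP; split; lra.
Qed.

Lemma eta_eq0 z : cabs z < 1 -> (fm_eta nu z == 0) = (mrsv nu z == 1).
Proof.
move=> z1; have rz := regular_disk nuT z1; rewrite eta_mrsv ?ltW // subr_eq0 eq_sym.
by rewrite invr_eq1.
Qed.

Lemma eta_nonvanishing (u : C) : cabs u = 1 ->
  (forall e : R, 0 < e -> exists r : R, [/\ 1 - e < r, 0 < r < 1 & fm_eta nu (r%:C%C * u) != 0]) \/
  (forall n, (0 < n)%N -> fm_cint nu (fun s => toC s ^+ n) = 0).
Proof.
move=> u1; have [h|/existsNP[e /not_implyP[e0 h]]] := pselect (forall e : R, 0 < e ->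
  exists r : R, [/\ 1 - e < r, 0 < r < 1 & fm_eta nu (r%:C%C * u) != 0]); first by left.
right; pose d := Num.min e 1.
apply: (@radial_moments_eq0 u d u1); first by rewrite lt_min e0 ltr01.
move=> r /andP[r1 r2] r3; apply/eqP; rewrite -eta_eq0; last by rewrite cabsM cabs_real u1 mulr1.
apply: contra_notT h => h; exists r.
have de : d <= e by rewrite ge_min lexx.
have d1 : d <= 1 by rewrite ge_min lexx orbT.
by split=> //; [lra|apply/andP; split; lra].
Qed.

Lemma moments_eq0_Cset t : (forall n, (0 < n)%N -> fm_cint nu (fun s => toC s ^+ n) = 0) ->
  ~ fm_Cset nu t.
Proof.
move=> m0 tC; have [t1 _] := tC; have rt := regular_Cset tC.
have h z : odisk z -> mrsv nu z = 1.
  move=> z1; apply: (@mrsv_eq1_disk 0); rewrite ?cabs0 ?subr0 //.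
  - by rewrite -(trem0 0) trem_origin (_ : (fun _ => _) = fun=> 1) ?cint_cst //; apply/funext => s.
  - by move=> n n0; rewrite trem_origin m0.
have PF : ProperFilter (cnear (@odisk R) t) by apply: cnear_odisk_proper; rewrite t1.
have e1 : mrsv nu t = 1.
  apply: (@ctends_unique _ _ (cnear (@odisk R) t) _ _ (mrsv nu)).
  - by move=> e e0; apply: (cnear_sub (@subsetT _ _)); exact: mrsv_cvg.
  - by move=> e e0; exists 1 => // z zD _; rewrite h // subrr cabs0.
have := Re_mrsv nuT rt; rewrite e1 t1 expr1n subrr mul0r /=; lra.
Qed.

End Taylor.

Lemma cvg_le_bound (R : realType) (X : Type) (F : set_system X) {PF : ProperFilter F}
  (u : X -> R) (l c : R) :
  u x @[x --> F] --> l -> (\forall x \near F, u x <= c) -> l <= c.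
Proof.
move=> ul uc; rewrite -(cvg_lim (@Rhausdorff R) ul); apply: limr_le => //.
by apply/cvg_ex; exists l.
Qed.

Section RealCover.
Variable R : realType.

Lemma IVT_between (v : R -> R) (a b x : R) : a <= b -> {within `[a, b], continuous v} ->
  Num.min (v a) (v b) <= x <= Num.max (v a) (v b) -> exists2 c, a <= c <= b & v c = x.
Proof.
by move=> ab cv h; have [c] := IVT ab cv h; rewrite in_itv /= => cab <-; exists c.
Qed.

Lemma continuous_inj_cover (v : R -> R) (d : R) : 0 < d ->
  {within `[- d, d], continuous v} ->
  (forall x y, - d <= x <= d -> - d <= y <= d -> v x = v y -> x = y) -> v 0 = 0 ->
  exists2 m : R, 0 < m & forall x, `|x| < m -> exists2 y, - d <= y <= d & v y = x.
Proof.
move=> d0 cv vinj v0.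
have cv1 : {within `[0, d], continuous v}.
  by apply: continuous_subspaceW cv => x /=; rewrite !in_itv /= => /andP[x0 ->]; rewrite andbT; lra.
have cv2 : {within `[- d, 0], continuous v}.
  by apply: continuous_subspaceW cv => x /=; rewrite !in_itv /= => /andP[-> x0] /=; lra.
have nz y : - d <= y <= d -> y != 0 -> v y != 0.
  move=> yd; apply: contra_neq => vy; apply: vinj => //; last by rewrite vy v0.
  by apply/andP; split; lra.
have vd : v d != 0 by apply: nz; [apply/andP; split; lra|rewrite gt_eqF].
have vd' : v (- d) != 0 by apply: nz; [apply/andP; split; lra|rewrite oppr_eq0 gt_eqF].
have nodd x : x != 0 -> Num.min 0 (v d) <= x <= Num.max 0 (v d) ->
    Num.min (v (- d)) 0 <= x <= Num.max (v (- d)) 0 -> False.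
  move=> x0 h1 h2.
  have [|c1 c1d e1] := @IVT_between v 0 d x (ltW d0) cv1; first by rewrite v0.
  have [||c2 c2d e2] := @IVT_between v (- d) 0 x _ cv2; [lra|by rewrite v0|].
  have e : c1 = c2.
    by apply: vinj; rewrite ?e1 ?e2 //; apply/andP; split; lra.
  have c0 : c1 = 0 by lra.
  by move: x0; rewrite -e1 c0 v0 eqxx.
exists (Num.min `|v d| `|v (- d)|); first by rewrite lt_min !normr_gt0 vd vd'.
move=> x; rewrite lt_min => /andP[xd xd'].
apply: IVT_between => //; first by lra.
have [p|p|p] := ltgtP (v d) 0; last by rewrite p eqxx in vd.
- have [q|q|q] := ltgtP (v (- d)) 0; last by rewrite q eqxx in vd'.
  + exfalso; pose y := Num.max (v d) (v (- d)).
    have y0 : y < 0 by rewrite gt_max p.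
    apply: (nodd y); first by rewrite lt_eqF.
      by rewrite ge_min [X in _ && X]le_max [y <= 0]ltW // /y !le_max lexx !orbT.
    by rewrite ge_min [X in _ && X]le_max [y <= 0]ltW // /y !le_max lexx !orbT.
  + rewrite (ltr0_norm p) in xd; rewrite (gtr0_norm q) in xd'.
    by move: xd xd'; rewrite !ltr_norml ge_min le_max => /andP[a1 a2] /andP[a3 a4]; apply/andP; split; apply/orP; [right|left]; lra.
- have [q|q|q] := ltgtP (v (- d)) 0; last by rewrite q eqxx in vd'.
  + rewrite (gtr0_norm p) in xd; rewrite (ltr0_norm q) in xd'.
    by move: xd xd'; rewrite !ltr_norml ge_min le_max => /andP[a1 a2] /andP[a3 a4]; apply/andP; split; apply/orP; [left|right]; lra.
  + exfalso; pose y := Num.min (v d) (v (- d)).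
    have y0 : 0 < y by rewrite lt_min p.
    apply: (nodd y); first by rewrite gt_eqF.
      by rewrite ge_min [X in _ && X]le_max [0 <= y]ltW // /y !ge_min lexx !orbT.
    by rewrite ge_min [X in _ && X]le_max [0 <= y]ltW // /y !ge_min lexx !orbT.
Qed.

Local Notation C := R[i].
Local Notation cabs := (@fm_cabs R).

Definition cayley_inv (w : C) : R := complex.Im w / (1 + complex.Re w).

Lemma cayleyK y : cayley_inv (cayley y) = y.
Proof.
have n0 : 1 + y ^+ 2 != 0 by rewrite gt_eqF // ltr_pwDl ?sqr_ge0.
have -> : cayley y = (((1 - y ^+ 2) / (1 + y ^+ 2)) +i* (2 * y / (1 + y ^+ 2)))%C.
  apply: (mulIf (cayley_den_neq0 y)); rewrite /cayley divfK ?cayley_den_neq0 //.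
  by apply: complex_eq; rewrite /=; field.
rewrite /cayley_inv /=; field; rewrite n0 /=.
have -> : 1 + y ^+ 2 + (1 - y ^+ 2) = 2 by ring.
by rewrite pnatr_eq0.
Qed.

Lemma cayley_invK w : cabs w = 1 -> cabs (w - 1) <= 1 ->
  `|cayley_inv w| <= cabs (w - 1) /\ cayley (cayley_inv w) = w.
Proof. by move=> w1 wd; have [y yd e] := cayley_surj w1 wd; rewrite e cayleyK -e. Qed.

Lemma cayley_cvg (y : R) : ctends (nbhs y) (@cayley R) (cayley y).
Proof.
move=> e e0; have e2 : 0 < e / 2 by rewrite divr_gt0.
apply/nbhs_ballP; exists (e / 2) => // x; rewrite /ball /= distrC => xy.
by apply: le_lt_trans (cayley_lipschitz _ _) _; move: xy; lra.
Qed.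

Lemma arc_image_cover (f : C -> C) (t : C) (d : R) : cabs t = 1 -> 0 < d ->
  (forall z, cabs z = 1 -> cabs (z - t) < d -> cabs (f z) = 1) ->
  (forall z, cabs z <= 1 -> fm_cont_within (@fm_cdisk R) f z) ->
  (forall z w, cabs z = 1 -> cabs w = 1 -> cabs (z - t) < d -> cabs (w - t) < d ->
     f z = f w -> z = w) ->
  exists2 m : R, 0 < m & forall w, cabs w = 1 -> cabs (w - f t) < m ->
    exists z, [/\ cabs z = 1, cabs (z - t) < d & f z = w].
Proof.
move=> t1 d0 f1 fc finj; have t0 := cabs1_neq0 t1.
have ft1 : cabs (f t) = 1 by apply: f1; rewrite // subrr cabs0.
have ft0 := cabs1_neq0 ft1.
pose zy y := t * cayley y; pose W y := f (zy y) / f t.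
have zy1 y : cabs (zy y) = 1 by rewrite cabsM t1 cayley_unit mulr1.
have zyd y : cabs (zy y - t) <= 2 * `|y|.
  rewrite /zy -[X in _ - X]mulr1 -mulrBr cabsM t1 mul1r -(cayley0 R).
  by apply: le_trans (cayley_lipschitz _ _) _; rewrite subr0.
have Wc y : ctends (nbhs y) W (W y).
  apply: ctendsM; last exact: ctends_cst.
  apply: (@ctends_comp _ _ (nbhs y) _ (@fm_cdisk R) zy f).
  - by apply: filterE => x; rewrite /fm_cdisk /= zy1.
  - by apply: ctendsM; [exact: ctends_cst|exact: cayley_cvg].
  - have zy1' : cabs (zy y) <= 1 by rewrite zy1.
    by move=> e e0; have [del del0 h] := fc (zy y) zy1' e e0; exists del.
have W0 : W 0 = 1 by rewrite /W /zy cayley0 mulr1 divff.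
have [d1 d10 Wd1] : exists2 d1 : R, 0 < d1 & forall y, `|y| < d1 -> cabs (W y - 1) < 1.
  have := Wc 0 1 ltr01; rewrite W0 => /nbhs_ballP[e e0 he].
  by exists e => // y ye; apply: he; rewrite /ball /= sub0r normrN.
pose d2 := Num.min (d1 / 2) (d / 4).
have d20 : 0 < d2 by rewrite lt_min !divr_gt0.
have d21 : d2 <= d1 / 2 by rewrite ge_min lexx.
have d22 : d2 <= d / 4 by rewrite ge_min lexx orbT.
have yn y : - d2 <= y <= d2 -> `|y| <= d2 by rewrite ler_norml.
have Wn y : - d2 <= y <= d2 -> cabs (W y - 1) < 1.
  by move=> /yn h; apply: Wd1; apply: le_lt_trans h _; lra.
have zn y : - d2 <= y <= d2 -> cabs (zy y - t) < d.
  by move=> /yn h; apply: le_lt_trans (zyd y) _; lra.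
have W1 y : - d2 <= y <= d2 -> cabs (W y) = 1.
  by move=> h; rewrite cabs_div ft1 divr1 f1 // zn.
have ReW y : - d2 <= y <= d2 -> 0 < 1 + complex.Re (W y).
  move=> h; have := normr_Re_le (W y - 1); have := Wn y h.
  rewrite cReD cReN /= => h1 h2; have := le_lt_trans h2 h1.
  by rewrite ltr_norml => /andP[]; lra.
pose v y := cayley_inv (W y).
have [] := @continuous_inj_cover v d2 d20.
- apply: continuous_in_subspaceT => y; rewrite inE /= in_itv /= => yd.
  have /ctendsP[cr ci] := Wc y.
  apply: cvgM; first exact: ci.
  apply: cvgV; first by rewrite gt_eqF // ReW.
  by apply: cvgD; [exact: cvg_cst|exact: cr].
- move=> x y xd yd vxy.
  have : W x = W y.
    have [_ <-] := cayley_invK (W1 x xd) (ltW (Wn x xd)).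
    by have [_ <-] := cayley_invK (W1 y yd) (ltW (Wn y yd)); rewrite -/(v x) vxy.
  move=> /(divIf ft0) /(finj _ _ (zy1 x) (zy1 y) (zn _ xd) (zn _ yd)) /(mulfI t0).
  by move=> e; rewrite -(cayleyK x) e cayleyK.
- by rewrite /v W0 /cayley_inv /= mul0r.
move=> m m0 hm; exists (Num.min m 1); first by rewrite lt_min m0 ltr01.
move=> w w1; rewrite lt_min => /andP[wm w11].
have wf1 : cabs (w / f t) = 1 by rewrite cabs_div w1 ft1 divr1.
have wfd : cabs (w / f t - 1) = cabs (w - f t).
  by rewrite -[1](divff ft0) -mulrBl cabs_div ft1 divr1.
have [|yb ye] := cayley_invK wf1; first by rewrite wfd ltW.
have [|y yd vy] := hm (cayley_inv (w / f t)).
  by apply: le_lt_trans yb _; rewrite wfd.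
exists (zy y); split; [exact: zy1|exact: zn|].
have [_ e] := cayley_invK (W1 y yd) (ltW (Wn y yd)).
have : W y = w / f t by rewrite -e -/(v y) vy ye.
by move/(divIf ft0).
Qed.

End RealCover.

Section Subordination.
Variable R : realType.
Local Notation C := R[i].
Local Notation cabs := (@fm_cabs R).

Lemma subordination_sym (mu1 mu2 mu : probability (R * R)%type R) (w1 w2 : C -> C) :
  subordination mu1 mu2 mu w1 w2 -> subordination mu2 mu1 mu w2 w1.
Proof.
move=> [h1 h2]; split=> [w [->|->]|z z1]; [by apply: h1; right|by apply: h1; left|].
by have [e1 e2 e3] := h2 z z1; split=> //; rewrite [w2 z * _]mulrC.
Qed.

Variables (mu1 mu2 mu : probability (R * R)%type R) (w1 w2 : C -> C).
Hypotheses (p1 : prob_on_T mu1) (p2 : prob_on_T mu2) (p : prob_on_T mu).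
Hypothesis sub : subordination mu1 mu2 mu w1 w2.

Lemma subordination_cvg t : cabs t <= 1 -> ctends (cnear (@fm_cdisk R) t) w1 (w1 t).
Proof.
move=> t1; have [_ ct _ _] := sub.1 w1 (or_introl erefl).
by move=> e e0; have [d d0 h] := ct t t1 e e0; exists d.
Qed.

Lemma cnear_odisk (t : C) : cnear (@fm_cdisk R) t `<=` cnear (@odisk R) t.
Proof. by apply: cnear_sub => z; exact: ltW. Qed.

Lemma subordination_cvg_odisk t : cabs t <= 1 -> ctends (cnear (@odisk R) t) w1 (w1 t).
Proof. by move=> t1 e e0; apply: cnear_odisk; exact: subordination_cvg. Qed.

Lemma fixed_point_half z : cabs z < 1 -> fm_eta mu z != 0 -> cabs (w2 z) < 1 ->
  w1 z = z * hfun mu2 (w2 z) /\ cabs (w1 z) <= cabs z.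
Proof.
move=> z1 ez w21; have [e1 e2 e3] := sub.2 z z1.
have z0 : z != 0 by apply: contra_neq ez => z0; rewrite e3 z0 invr0 mulr0.
have w20 : w2 z != 0 by apply: contra_neq ez => w0; rewrite e3 w0 mulr0 mul0r.
have r2 := regular_disk p2 w21.
have e : w1 z = z * hfun mu2 (w2 z).
  apply: (mulIf w20); apply: (divIf z0); rewrite -e3 e2 eta_hfun ?ltW //.
  by field.
by split=> //; rewrite e cabsM ler_piMr ?cabs_ge0 // hfun_le1 ?ltW.
Qed.

Lemma cabs_eta_le z : cabs z < 1 -> cabs (fm_eta mu z) <= cabs z.
Proof.
move=> z1; have rz := regular_disk p z1.
by rewrite (eta_hfun p rz (ltW z1)) cabsM ler_piMr ?cabs_ge0 // hfun_le1 ?ltW.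
Qed.

End Subordination.

Section FixedPoint.
Variable R : realType.
Local Notation C := R[i].
Local Notation cabs := (@fm_cabs R).
Variables (mu1 mu2 mu : probability (R * R)%type R) (w1 w2 : C -> C).
Hypotheses (p1 : prob_on_T mu1) (p2 : prob_on_T mu2) (p : prob_on_T mu).
Hypothesis sub : subordination mu1 mu2 mu w1 w2.

(* [fm_eta mu1] and [fm_eta mu2] carry junk values at points of the unit circle meeting the
   support. These are never met here: w1 z and w2 z cannot both have modulus 1, because
   |w1 z * w2 z| = |z * eta_mu z| <= |z|^2, and one of them lying in the disk forces the other. *)
Lemma fixed_point z : cabs z < 1 -> fm_eta mu z != 0 ->
  [/\ w1 z = z * hfun mu2 (w2 z), w2 z = z * hfun mu1 (w1 z),
      cabs (w1 z) <= cabs z, cabs (w2 z) <= cabs z & mrsv mu1 (w1 z) = mrsv mu z].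
Proof.
move=> z1 ez; have sub' := subordination_sym sub.
have [le1 _ _ _] := sub.1 w1 (or_introl erefl); have [le2 _ _ _] := sub.1 w2 (or_intror erefl).
have [e1 e2 e3] := sub.2 z z1.
have z0 : 0 < cabs z.
  by rewrite cabs_gt0; apply: contra_neq ez => z0; rewrite e3 z0 invr0 mulr0.
have [[e21 l1] [e12 l2]] : (w1 z = z * hfun mu2 (w2 z) /\ cabs (w1 z) <= cabs z) /\
    (w2 z = z * hfun mu1 (w1 z) /\ cabs (w2 z) <= cabs z).
  have [w21|w21] := ltP (cabs (w2 z)) 1.
    have h := fixed_point_half p2 sub z1 ez w21; split=> //.
    by apply: (fixed_point_half p1 sub' z1 ez); exact: le_lt_trans h.2 z1.
  have [w11|w11] := ltP (cabs (w1 z)) 1.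
    have h := fixed_point_half p1 sub' z1 ez w11; split=> //.
    by apply: (fixed_point_half p2 sub z1 ez); exact: le_lt_trans h.2 z1.
  exfalso; have := cabs_eta_le p z1; rewrite e3 cabs_div cabsM leNgt => /negP; apply.
  rewrite ltr_pdivlMr //; apply: (@lt_le_trans _ _ 1); first by nra.
  exact: mulr_ege1.
split=> //; have w11 := le_lt_trans l1 z1.
have := e1; rewrite !eta_mrsv ?ltW //; [|exact: regular_disk..].
by move=> /addrI /oppr_inj /invr_inj ->.
Qed.

End FixedPoint.

Section Forward.
Variable R : realType.
Local Notation C := R[i].
Local Notation cabs := (@fm_cabs R).
Variables (mu1 mu2 mu : probability (R * R)%type R) (w1 w2 : C -> C).
Hypotheses (p1 : prob_on_T mu1) (p2 : prob_on_T mu2) (p : prob_on_T mu).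
Hypothesis sub : subordination mu1 mu2 mu w1 w2.
Variable t : C.
Hypothesis tC : fm_Cset mu t.

Let t1 : cabs t = 1. Proof. by case: tC. Qed.
Let rt : regular mu t. Proof. exact: regular_Cset. Qed.
Let t1' : cabs t <= 1. Proof. by rewrite t1. Qed.

Lemma eta_cvg_odisk : ctends (cnear (@odisk R) t) (fm_eta mu) (fm_eta mu t).
Proof.
have h : ctends (cnear (@odisk R) t) (fun z => 1 - (mrsv mu z)^-1) (1 - (mrsv mu t)^-1).
  apply: ctendsB; first exact: ctends_cst.
  apply: ctendsV; first exact: mrsv_neq0.
  by move=> e e0; apply: (cnear_sub (@subsetT _ _)); exact: mrsv_cvg.
rewrite eta_mrsv // => e e0; have [d d0 hd] := h e e0.
by exists d => // z z1 zt; rewrite eta_mrsv ?ltW //; [exact: hd|exact: regular_disk].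
Qed.

Lemma Cset_local : exists d Q : R, [/\ 0 < d, 0 < Q,
  (forall z, cabs z < 1 -> cabs (z - t) < d -> fm_eta mu z != 0 /\ nrsv mu z <= Q) &
  (forall z z', cabs (z - t) < d -> cabs (z' - t) < d -> 8^-1 <= cabs (grsv mu z z'))].
Proof.
have e0 : fm_eta mu t != 0 by rewrite -cabs_gt0 eta_unit.
have [d1 d10 h1] := ctends_neq0 e0 eta_cvg_odisk.
have e8 : 0 < 8^-1 :> R by rewrite invr_gt0.
have [d2 d20 h2] := grsv_near p rt e8.
have n4 := nrsv_ge14 p rt t1'.
exists (Num.min d1 d2), (nrsv mu t + 8^-1); split.
- by rewrite lt_min d10.
- by lra.
- move=> z z1; rewrite lt_min => /andP[zd1 zd2]; split; first exact: h1.
  have := le_lt_trans (Re_le_cabs _) (h2 z z zd2 zd2).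
  by rewrite cReD cReN -/(nrsv mu z) -/(nrsv mu t); lra.
- move=> z z'; rewrite !lt_min => /andP[_ z2] /andP[_ z2'].
  have := cabs_ge_sub (grsv mu t t) (grsv mu t t - grsv mu z z').
  rewrite opprB addrCA subrr addr0 [cabs (grsv mu t t - _)]cabs_distC => h.
  have g4 : 4^-1 <= cabs (grsv mu t t) by exact: le_trans n4 (Re_le_cabs _).
  by have := h2 z z' z2 z2'; lra.
Qed.

Lemma nrsv_subordination z : cabs z < 1 -> fm_eta mu z != 0 ->
  (1 - cabs (w1 z) ^+ 2) * nrsv mu1 (w1 z) = (1 - cabs z ^+ 2) * nrsv mu z.
Proof.
move=> z1 ez; have [_ _ l1 _ e] := fixed_point p1 p2 p sub z1 ez.
have w11 := le_lt_trans l1 z1.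
rewrite -Re_mrsv //; last exact: regular_disk.
by rewrite -(Re_mrsv p) ?e //; exact: regular_disk.
Qed.

Lemma nrsv_subordination_le z : cabs z < 1 -> fm_eta mu z != 0 ->
  nrsv mu1 (w1 z) <= nrsv mu z.
Proof.
move=> z1 ez; have e := nrsv_subordination z1 ez.
have [_ _ l1 _ _] := fixed_point p1 p2 p sub z1 ez.
have w11 := le_lt_trans l1 z1.
have n0 : 4^-1 <= nrsv mu z by apply: nrsv_ge14 => //; [exact: regular_disk|exact: ltW].
have n1 : 4^-1 <= nrsv mu1 (w1 z) by apply: nrsv_ge14 => //; [exact: regular_disk|exact: ltW].
have c0 := cabs_ge0 z; have c1 := cabs_ge0 (w1 z).
have le : cabs (w1 z) ^+ 2 <= cabs z ^+ 2 by rewrite lerXn2r ?nnegrE.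
have z2 : 0 < 1 - cabs z ^+ 2 by rewrite subr_gt0 expr_lt1.
have : (1 - cabs z ^+ 2) * nrsv mu1 (w1 z) <= (1 - cabs z ^+ 2) * nrsv mu z.
  by rewrite -e ler_wpM2r; lra.
by rewrite ler_pM2l.
Qed.

Lemma cabs_subordination_ge z : cabs z < 1 -> fm_eta mu z != 0 ->
  1 - cabs (w1 z) ^+ 2 <= 4 * nrsv mu z * (1 - cabs z ^+ 2).
Proof.
move=> z1 ez; have rz := regular_disk p z1.
have [_ _ l1 _ e] := fixed_point p1 p2 p sub z1 ez.
have w11 := le_lt_trans l1 z1; have r1 := regular_disk p1 w11.
have [e1 _ _] := sub.2 z z1.
have le : cabs (fm_eta mu z) <= cabs (w1 z).
  by rewrite e1 (eta_hfun p1 r1 (ltW w11)) cabsM ler_piMr ?cabs_ge0 // hfun_le1 ?ltW.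
have a4 := cabs_mrsv_ge p rz (ltW z1).
have a0 : 0 < cabs (mrsv mu z) by apply: lt_le_trans a4.
have eta2 : (1 - cabs (fm_eta mu z) ^+ 2) * cabs (mrsv mu z) ^+ 2 =
    (1 - cabs z ^+ 2) * nrsv mu z.
  rewrite -Re_mrsv // eta_mrsv ?ltW // mulrBl -exprMn -cabsM mulrBl mulVf; last exact: mrsv_neq0 (ltW z1).
  by rewrite !mul1r !cabs_sqr; case: (mrsv mu z) => x y /=; ring.
have le2 : cabs (fm_eta mu z) ^+ 2 <= cabs (w1 z) ^+ 2 by rewrite lerXn2r ?nnegrE ?cabs_ge0.
have lz := le_trans le l1; have lz1 := le_lt_trans lz z1.
have eta1 : 0 <= 1 - cabs (fm_eta mu z) ^+ 2 by rewrite subr_ge0 expr_le1 ?cabs_ge0 // ltW.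
have a16 : 4^-1 <= cabs (mrsv mu z) ^+ 2 by nra.
apply: (@le_trans _ _ (1 - cabs (fm_eta mu z) ^+ 2)); first by lra.
by nra.
Qed.

Let odiskF (z : C) := cnear (@odisk R) z.

Lemma cabs_sqr_cvg z (f : C -> C) l : ctends (odiskF z) f l ->
  cabs (f x) ^+ 2 @[x --> odiskF z] --> cabs l ^+ 2.
Proof.
by move=> fl; rewrite expr2; under eq_fun do rewrite expr2; apply: cvgM; exact: ctends_cabs.
Qed.

Variables (d Q : R).
Hypotheses (d0 : 0 < d) (Q0 : 0 < Q).
Hypothesis loc : forall z, cabs z < 1 -> cabs (z - t) < d -> fm_eta mu z != 0 /\ nrsv mu z <= Q.
Hypothesis gloc : forall z z', cabs (z - t) < d -> cabs (z' - t) < d -> 8^-1 <= cabs (grsv mu z z').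

Lemma near_arc x : cabs (x - t) < d -> \forall z \near odiskF x, cabs z < 1 /\ cabs (z - t) < d.
Proof.
move=> xt; exists (d - cabs (x - t)); first by rewrite subr_gt0.
move=> z z1 zx; split => //; apply: le_lt_trans (cabs_dist_triangle z x t) _; lra.
Qed.

Lemma arc_unit x : cabs x = 1 -> cabs (x - t) < d -> cabs (w1 x) = 1.
Proof.
move=> x1 xt; have x1' : cabs x <= 1 by rewrite x1.
have PF := cnear_odisk_proper x1'.
have [le1 _ _ _] := sub.1 w1 (or_introl erefl).
apply/eqP; rewrite eq_le le1 //= -(@expr_ge1 _ 2) ?cabs_ge0 //.
have h : 1 - cabs (w1 z) ^+ 2 - 4 * Q * (1 - cabs z ^+ 2) @[z --> odiskF x] -->
    1 - cabs (w1 x) ^+ 2 - 4 * Q * (1 - cabs x ^+ 2).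
  have a := cabs_sqr_cvg (subordination_cvg_odisk sub x1').
  have b := cabs_sqr_cvg (@ctends_id _ (@odisk R) x).
  have c1 : (1 : R) @[_ --> odiskF x] --> (1 : R) by exact: cvg_cst.
  have c4 : 4 * Q @[_ --> odiskF x] --> 4 * Q by exact: cvg_cst.
  exact: (cvgB (cvgB c1 a) (cvgM c4 (cvgB c1 b))).
have := cvg_le_bound (c := 0) h; rewrite x1 expr1n subrr mulr0 subr0 subr_le0; apply.
apply: filterS (near_arc xt) => z [z1 zt]; have [ez nz] := loc z1 zt.
have := cabs_subordination_ge z1 ez.
have : cabs z ^+ 2 < 1 by rewrite expr_lt1 ?cabs_ge0.
by nra.
Qed.

Lemma radial_cvg x : ctends (1 : R)^'- (fun r : R => r%:C%C * x) x.
Proof.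
rewrite -[X in ctends _ _ X](mul1r x); apply: ctendsM; last exact: ctends_cst.
by apply: (@ctends_real _ _ _ _ id 1); exact: cvg_at_left_filter.
Qed.

(* (1 - z z'^conj) <X_z, X_z'>_mu = (1 - w1(z) w1(z')^conj) <X_w1(z), X_w1(z')>_mu1, where the first
   inner product is bounded below and the second one above, so w1 cannot identify two points. *)
Lemma arc_inj x x' : cabs x = 1 -> cabs x' = 1 -> cabs (x - t) < d -> cabs (x' - t) < d ->
  w1 x = w1 x' -> x = x'.
Proof.
move=> x1 x1' xt xt' ww.
have nr : \forall r \near (1 : R)^'-, 0 < r < 1.
  near=> r; apply/andP; split; [near: r; exact: nbhs_left_gt|by near: r; exact: nbhs_left_lt].
have nd y : cabs y = 1 -> cabs (y - t) < d ->
    \forall r \near (1 : R)^'-, cabs (r%:C%C * y) < 1 /\ cabs (r%:C%C * y - t) < d.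
  move=> y1 yt; have e0 : 0 < d - cabs (y - t) by rewrite subr_gt0.
  apply: filterS2 nr (@radial_cvg y _ e0) => r /andP[r0 r1] ry; split.
    by rewrite cabs_realM ?ltW // y1 mulr1.
  by apply: le_lt_trans (cabs_dist_triangle _ y t) _; lra.
have wc y : cabs y = 1 -> ctends (1 : R)^'- (fun r : R => w1 (r%:C%C * y)) (w1 y).
  move=> y1; apply: (@ctends_comp _ _ _ _ (@fm_cdisk R)); last by apply: (subordination_cvg sub); rewrite y1.
  - by apply: filterS nr => r /andP[r0 r1]; rewrite /fm_cdisk /= cabs_realM ?(ltW r0) // y1 mulr1 ltW.
  - exact: radial_cvg.
have h : cabs (1 - (r%:C%C * x) * (r%:C%C * x')^*%C) -
     8 * Q * cabs (1 - w1 (r%:C%C * x) * (w1 (r%:C%C * x'))^*%C) @[r --> (1 : R)^'-] -->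
     cabs (1 - x * x'^*%C) - 8 * Q * cabs (1 - w1 x * (w1 x')^*%C).
  apply: cvgB.
    apply: ctends_cabs; apply: ctendsB; first exact: ctends_cst.
    by apply: ctendsM; [|apply: ctends_conj]; exact: radial_cvg.
  apply: cvgM; first exact: cvg_cst.
  apply: ctends_cabs; apply: ctendsB; first exact: ctends_cst.
  by apply: ctendsM; [|apply: ctends_conj]; exact: wc.
have := cvg_le_bound (c := 0) h; rewrite ww mul_conjc (arc_unit x1' xt') expr1n subrr cabs0 mulr0 subr0.
have H : cabs (1 - x * x'^*%C) <= 0 -> x = x'.
  rewrite cabs_one_sub_conj // => h0; apply/eqP; rewrite -subr_eq0 -cabs_eq0.
  by rewrite eq_le h0 cabs_ge0.
move=> hh; apply/H/hh; apply: filterS2 (nd _ x1 xt) (nd _ x1' xt') => r [z1 zt] [z1' zt'].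
set z := r%:C%C * x in z1 zt *; set z' := r%:C%C * x' in z1' zt' *.
have [ez nz] := loc z1 zt; have [ez' nz'] := loc z1' zt'.
have [_ _ l1 _ e] := fixed_point p1 p2 p sub z1 ez.
have [_ _ l1' _ e'] := fixed_point p1 p2 p sub z1' ez'.
have r1 := regular_disk p1 (le_lt_trans l1 z1); have r1' := regular_disk p1 (le_lt_trans l1' z1').
have eq : cabs (1 - z * z'^*%C) * cabs (grsv mu z z') =
    cabs (1 - w1 z * (w1 z')^*%C) * cabs (grsv mu1 (w1 z) (w1 z')).
  by rewrite -!cabsM (grsvE p1 r1 r1') e e' grsvE //; exact: regular_disk.
have gQ : cabs (grsv mu1 (w1 z) (w1 z')) <= Q.
  rewrite -ler_sqr ?nnegrE ?cabs_ge0 ?(ltW Q0) //.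
  apply: le_trans (grsv_cauchy_schwarz p1 r1 r1') _; rewrite expr2.
  apply: ler_pM; [exact: le_trans (sqr_ge0 _) (nrsv_ge p1 r1)|
    exact: le_trans (sqr_ge0 _) (nrsv_ge p1 r1')| |].
  - exact: le_trans (nrsv_subordination_le z1 ez) nz.
  - exact: le_trans (nrsv_subordination_le z1' ez') nz'.
have g8 := gloc zt zt'.
have A0 := cabs_ge0 (1 - z * z'^*%C); have B0 := cabs_ge0 (1 - w1 z * (w1 z')^*%C).
by nra.
Unshelve. all: by end_near. Qed.

Lemma Cset_subordination : fm_Cset mu1 (w1 t).
Proof.
have [_ ct _ _] := sub.1 w1 (or_introl erefl).
have [m m0 hm] := arc_image_cover t1 d0 (fun z z1 zt => arc_unit z1 zt) ct arc_inj.
apply: (Cset_of_bound p1 (del := m) (Q := Q)) => //.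
- by apply: arc_unit => //; rewrite subrr cabs0.
- exact: ltW.
move=> w ww1 wm e e0; have [x [x1 xt xw]] := hm w ww1 wm.
have x1' : cabs x <= 1 by rewrite x1.
have PF := cnear_odisk_proper x1'.
have [z [[z1 zt] zw]] := @filter_ex _ _ PF _ (filterI (near_arc xt) (subordination_cvg_odisk sub x1' e0)).
have [ez nz] := loc z1 zt; have [_ _ l1 _ _] := fixed_point p1 p2 p sub z1 ez.
exists (w1 z); split; [exact: le_lt_trans l1 z1|by rewrite -xw|].
exact: le_trans (nrsv_subordination_le z1 ez) nz.
Qed.

Lemma mrsv_subordination : mrsv mu1 (w1 t) = mrsv mu t.
Proof.
have PF := cnear_odisk_proper t1'.
apply: (@ctends_unique _ _ (odiskF t) _ _ (mrsv mu)).
  have h : ctends (odiskF t) (fun z => mrsv mu1 (w1 z)) (mrsv mu1 (w1 t)).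
    apply: (@ctends_comp _ _ _ _ setT); first exact: filterE.
    - exact: (subordination_cvg_odisk sub t1').
    - by apply: mrsv_cvg => //; apply: regular_Cset; exact: Cset_subordination.
  have tt0 : cabs (t - t) < d by rewrite subrr cabs0.
  move=> e e0; apply: filterS2 (near_arc tt0) (h e e0) => z [z1 zt].
  by have [ez _] := loc z1 zt; have [_ _ _ _ ->] := fixed_point p1 p2 p sub z1 ez.
by move=> e e0; apply: (cnear_sub (@subsetT _ _)); exact: mrsv_cvg.
Qed.

End Forward.

Section DsetFacts.
Variable R : realType.
Local Notation C := R[i].
Local Notation cabs := (@fm_cabs R).
Variables (mu1 mu2 : probability (R * R)%type R).
Hypotheses (p1 : prob_on_T mu1) (p2 : prob_on_T mu2).

Lemma psi_neq0 (nu : probability (R * R)%type R) t : prob_on_T nu -> fm_Cset nu t ->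
  cabs (fm_psi nu t * (fm_psi nu t + 1)) != 0.
Proof.
move=> pn tC; have [t1 _] := tC; have rt := regular_Cset tC.
have a0 : cabs (mrsv nu t) != 0 by rewrite cabs_eq0 mrsv_neq0 // t1.
by rewrite cabsM cabs_psi // psi_mrsv // subrK mulf_neq0.
Qed.

Lemma Vfun_ratio t1 t2 : fm_Cset mu1 t1 -> fm_Cset mu2 t2 -> fm_psi mu1 t1 = fm_psi mu2 t2 ->
  fm_Vfun mu1 t1 * fm_Vfun mu2 t2 / cabs (fm_psi mu1 t1 * (fm_psi mu1 t1 + 1)) ^+ 2 =
  kfun mu1 t1 * kfun mu2 t2.
Proof.
move=> C1 C2 e; have n0 := psi_neq0 p1 C1.
by rewrite (Vfun_kfun p1 C1) (Vfun_kfun p2 C2) -e; field.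
Qed.

Lemma Dset_eta q : fm_Dset mu1 mu2 q -> fm_eta mu1 q.1 = fm_eta mu2 q.2.
Proof. by move=> [_ [_ [e _]]]; rewrite /fm_eta e. Qed.

Lemma Dset_kfun q : fm_Dset mu1 mu2 q -> kfun mu1 q.1 * kfun mu2 q.2 < 1.
Proof. by move=> [C1 [C2 [e]]]; rewrite Vfun_ratio. Qed.

Lemma Dset_fixed_point q : fm_Dset mu1 mu2 q ->
  let u := q.1 * q.2 / fm_eta mu1 q.1 in
  [/\ cabs u = 1, q.2 = u * hfun mu1 q.1 & q.1 = u * hfun mu2 q.2].
Proof.
move=> qD; have ee := Dset_eta qD; case: qD => C1 [C2 _] u.
have [t1 _] := C1; have [t2 _] := C2.
have h1 : hfun mu1 q.1 != 0 by rewrite cabs1_neq0 // hfun_unit.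
have h2 : hfun mu2 q.2 != 0 by rewrite cabs1_neq0 // hfun_unit.
have n1 := cabs1_neq0 t1; have n2 := cabs1_neq0 t2.
have e1 : fm_eta mu1 q.1 = q.1 * hfun mu1 q.1.
  by apply: eta_hfun => //; [exact: regular_Cset|rewrite t1].
have e2 : fm_eta mu2 q.2 = q.2 * hfun mu2 q.2.
  by apply: eta_hfun => //; [exact: regular_Cset|rewrite t2].
split; first by rewrite /u cabs_div cabsM t1 t2 eta_unit // !divr1 mulr1.
- by rewrite /u e1; field; rewrite n1 h1.
- by rewrite /u ee e2; field; rewrite n2 h2.
Qed.

End DsetFacts.

Section ForwardSquare.
Variable R : realType.
Local Notation C := R[i].
Local Notation cabs := (@fm_cabs R).
Variables (mu1 mu2 mu : probability (R * R)%type R) (w1 w2 : C -> C).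
Hypotheses (p1 : prob_on_T mu1) (p2 : prob_on_T mu2) (p : prob_on_T mu).
Hypothesis sub : subordination mu1 mu2 mu w1 w2.

Lemma defect_subordination z : cabs z < 1 -> fm_eta mu z != 0 ->
  1 - cabs (w2 z) ^+ 2 =
  (1 - cabs z ^+ 2) + cabs z ^+ 2 * ((1 - cabs (w1 z) ^+ 2) * kfun mu1 (w1 z)).
Proof.
move=> z1 ez; have [_ -> l1 _ _] := fixed_point p1 p2 p sub z1 ez.
have w11 := le_lt_trans l1 z1; have r1 := regular_disk p1 w11.
by rewrite cabsM exprMn -hfun_cabs ?ltW //; ring.
Qed.

End ForwardSquare.

Section ForwardMain.
Variable R : realType.
Local Notation C := R[i].
Local Notation cabs := (@fm_cabs R).
Variables (mu1 mu2 mu : probability (R * R)%type R) (w1 w2 : C -> C).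
Hypotheses (p1 : prob_on_T mu1) (p2 : prob_on_T mu2) (p : prob_on_T mu).
Hypothesis sub : subordination mu1 mu2 mu w1 w2.
Variable t : C.
Hypothesis tC : fm_Cset mu t.

Lemma kfun_subordination_lt1 : fm_Cset mu1 (w1 t) -> fm_Cset mu2 (w2 t) ->
  kfun mu1 (w1 t) * kfun mu2 (w2 t) < 1.
Proof.
move=> C1 C2; have sub' := subordination_sym sub; have [t1 _] := tC.
have t1' : cabs t <= 1 by rewrite t1.
have [d [Q [d0 Q0 loc _]]] := Cset_local p tC.
have PF := cnear_odisk_proper t1'.
have kc : cabs z ^+ 2 * cabs z ^+ 2 * (kfun mu1 (w1 z) * kfun mu2 (w2 z)) @[z --> cnear (@odisk R) t]
    --> cabs t ^+ 2 * cabs t ^+ 2 * (kfun mu1 (w1 t) * kfun mu2 (w2 t)).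
  have comp (nu : probability (R * R)%type R) (w : C -> C) : prob_on_T nu -> fm_Cset nu (w t) ->
      ctends (cnear (@odisk R) t) w (w t) ->
      kfun nu (w z) @[z --> cnear (@odisk R) t] --> kfun nu (w t).
    move=> pn wC wc; have [wt1 _] := wC; have kc := kfun_cvg pn (regular_Cset wC) wt1.
    apply/cvgrPdist_lt => e e0; have /cvgrPdist_lt/(_ e e0) [del del0 h] := kc.
    by apply: filterS (wc _ del0) => z zw; exact: h.
  apply: cvgM; first by apply: cvgM; apply: cabs_sqr_cvg; exact: ctends_id.
  apply: cvgM; apply: comp => //; first exact: (subordination_cvg_odisk sub).
  exact: (subordination_cvg_odisk sub').
have Q4 : 0 < 4 * Q by rewrite mulr_gt0.
suff : cabs t ^+ 2 * cabs t ^+ 2 * (kfun mu1 (w1 t) * kfun mu2 (w2 t)) <= 1 - (4 * Q)^-1.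
  rewrite t1 expr1n !mul1r => /le_lt_trans; apply.
  by have : 0 < (4 * Q)^-1 by [rewrite invr_gt0]; lra.
apply: cvg_le_bound kc _; have tt0 : cabs (t - t) < d by rewrite subrr cabs0.
apply: filterS (near_arc tt0) => z [z1 zt]; have [ez nz] := loc z z1 zt.
have e1 := defect_subordination p1 p2 p sub z1 ez.
have e2 := defect_subordination p2 p1 p sub' z1 ez.
have [_ _ l1 l2 _] := fixed_point p1 p2 p sub z1 ez.
have u4 : 1 - cabs (w1 z) ^+ 2 <= 4 * Q * (1 - cabs z ^+ 2).
  apply: le_trans (cabs_subordination_ge p1 p2 p sub z1 ez) _.
  by rewrite ler_wpM2r ?subr_ge0 ?expr_le1 ?cabs_ge0 ?(ltW z1) // ler_wpM2l.
have k1 := kfun_ge0 p1 (regular_disk p1 (le_lt_trans l1 z1)).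
have k2 := kfun_ge0 p2 (regular_disk p2 (le_lt_trans l2 z1)).
have w11 : 0 < 1 - cabs (w1 z) ^+ 2 by rewrite subr_gt0 expr_lt1 ?cabs_ge0 // (le_lt_trans l1).
have zz : 0 < 1 - cabs z ^+ 2 by rewrite subr_gt0 expr_lt1 ?cabs_ge0.
have z20 := sqr_ge0 (cabs z).
move: e1 e2 u4 k1 k2 w11 zz z20.
set u1 := 1 - cabs (w1 z) ^+ 2; set u2 := 1 - cabs (w2 z) ^+ 2; set D := 1 - cabs z ^+ 2.
set K1 := kfun _ _; set K2 := kfun _ _; set Z := cabs z ^+ 2 => e1 e2 u4 k1 k2 w11 zz z20.
have e : u1 * (1 - Z * Z * (K1 * K2)) = D + Z * (D * K2) by rewrite mulrBr mulr1 {1}e2 e1; ring.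
have h0 : 0 <= Z * (D * K2) by apply: mulr_ge0 => //; apply: mulr_ge0 => //; exact: ltW.
have h1 : D <= u1 * (1 - Z * Z * (K1 * K2)) by rewrite e lerDl.
have h2 : u1 <= u1 * (4 * Q * (1 - Z * Z * (K1 * K2))).
  apply: le_trans u4 _; rewrite mulrCA ler_wpM2l //; exact: ltW.
have h3 : 1 <= 4 * Q * (1 - Z * Z * (K1 * K2)) by rewrite -(ler_pM2l w11) mulr1.
have h4 : (4 * Q)^-1 <= 1 - Z * Z * (K1 * K2).
  by rewrite -(ler_pM2l Q4) divff // gt_eqF.
by lra.
Qed.

Lemma forward_Dset : fm_Dset mu1 mu2 (w1 t, w2 t) /\
  w1 t * w2 t / fm_eta mu1 (w1 t) = t.
Proof.
have sub' := subordination_sym sub; have [t1 _] := tC; have rt := regular_Cset tC.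
have t1' : cabs t <= 1 by rewrite t1.
have [d [Q [d0 Q0 loc gloc]]] := Cset_local p tC.
have C1 := Cset_subordination p1 p2 p sub tC d0 Q0 loc gloc.
have C2 := Cset_subordination p2 p1 p sub' tC d0 Q0 loc gloc.
have m1 := mrsv_subordination p1 p2 p sub tC d0 Q0 loc gloc.
have m2 := mrsv_subordination p2 p1 p sub' tC d0 Q0 loc gloc.
have ps : fm_psi mu1 (w1 t) = fm_psi mu2 (w2 t).
  by rewrite !psi_mrsv ?m1 ?m2 //; exact: regular_Cset.
split.
  split=> //; split=> //; split=> //=; rewrite Vfun_ratio //.
  exact: kfun_subordination_lt1.
have [w1t _] := C1.
have -> : fm_eta mu1 (w1 t) = fm_eta mu t.
  by rewrite !eta_mrsv ?m1 ?w1t //; exact: regular_Cset.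
have PF := cnear_odisk_proper t1'.
have e0 : fm_eta mu t != 0 by rewrite -cabs_gt0 eta_unit.
have : t * fm_eta mu t = w1 t * w2 t.
  apply: (@ctends_unique _ _ (cnear (@odisk R) t) _ _ (fun z => z * fm_eta mu z)).
    by apply: ctendsM; [exact: ctends_id|exact: eta_cvg_odisk].
  have h : ctends (cnear (@odisk R) t) (fun z => w1 z * w2 z) (w1 t * w2 t).
    apply: ctendsM; first exact: (subordination_cvg_odisk sub).
    exact: (subordination_cvg_odisk sub').
  have nz := ctends_neq0 (cabs1_neq0 t1) (@ctends_id _ (@odisk R) t).
  have nD : \forall z \near cnear (@odisk R) t, cabs z < 1 by exists 1.
  move=> e e1; near=> z; have z1 : cabs z < 1 by near: z.
  have [_ _ ->] := sub.2 z z1; rewrite mulrC divfK; first by near: z; exact: h.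
  by near: z; exact: nz.
by move=> <-; rewrite mulfK.
Unshelve. all: by end_near. Qed.

End ForwardMain.

Section Julia.
Variable R : realType.
Local Notation C := R[i].
Local Notation cabs := (@fm_cabs R).

Lemma julia_real (n k J X r e : R) : 0 <= k -> 0 <= J -> 0 <= X <= 1 -> 0 < r < 1 -> 0 < e ->
  n ^+ 2 <= J * k * (1 - X) ->
  (n + (1 - r)) ^+ 2 / (1 - r ^+ 2 * X) <= (1 + e) * k * J + (1 + e^-1) * (1 - r).
Proof.
move=> k0 J0 /andP[X0 X1] /andP[r0 r1] e0 hn.
have i0 : 0 < e^-1 by rewrite invr_gt0.
have ei : e * e^-1 = 1 by rewrite divff ?gt_eqF.
have rX : r ^+ 2 * X <= r by nra.
have rX' : r ^+ 2 * X <= X by apply: ler_piMl => //; rewrite expr_le1 ?ltW.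
have den : 0 < 1 - r ^+ 2 * X by lra.
rewrite ler_pdivrMr //.
have h1 : (n + (1 - r)) ^+ 2 <= (1 + e) * n ^+ 2 + (1 + e^-1) * (1 - r) ^+ 2.
  have : 0 <= e^-1 * (e * n - (1 - r)) ^+ 2 by rewrite mulr_ge0 ?sqr_ge0 // ltW.
  have -> : e^-1 * (e * n - (1 - r)) ^+ 2 =
    (e * e^-1) * (e * n ^+ 2) - 2 * (e * e^-1) * (n * (1 - r)) + e^-1 * (1 - r) ^+ 2 by ring.
  by rewrite ei; nra.
apply: le_trans h1 _; rewrite [leRHS]mulrDl; apply: lerD.
- have -> : (1 + e) * k * J * (1 - r ^+ 2 * X) = (1 + e) * (J * k * (1 - r ^+ 2 * X)) by ring.
  apply: ler_wpM2l; first by lra.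
  apply: le_trans hn _; apply: ler_wpM2l; last by lra.
  exact: mulr_ge0.
- rewrite -mulrA; apply: ler_wpM2l; first by lra.
  by rewrite expr2; apply: ler_wpM2l; lra.
Qed.

(* Julia's lemma at a boundary point: the horocycle function |w - t|^2 / (1 - |w|^2) is
   multiplied by at most [kfun nu t], up to the error caused by the shrinking factor r. *)
Lemma julia_half (nu : probability (R * R)%type R) (t w u : C) (r e : R) : prob_on_T nu ->
  fm_Cset nu t -> cabs w < 1 -> cabs u = 1 -> 0 < r < 1 -> 0 < e ->
  cabs (r%:C%C * u * hfun nu w - u * hfun nu t) ^+ 2 /
    (1 - cabs (r%:C%C * u * hfun nu w) ^+ 2) <=
  (1 + e) * kfun nu t * (cabs (w - t) ^+ 2 / (1 - cabs w ^+ 2)) + (1 + e^-1) * (1 - r).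
Proof.
move=> pn tC w1 u1 r01 e0; have /andP[r0 r1] := r01; have [t1 _] := tC.
have rt := regular_Cset tC; have rw := regular_disk pn w1.
have w2 : 0 < 1 - cabs w ^+ 2 by rewrite subr_gt0 expr_lt1 ?cabs_ge0.
have t1' : cabs t <= 1 by rewrite t1.
have x1 := hfun_le1 pn rw (ltW w1); have c0 := cabs_ge0 (hfun nu w).
pose n := cabs (hfun nu w - hfun nu t).
have hn : n ^+ 2 <= cabs (w - t) ^+ 2 / (1 - cabs w ^+ 2) * kfun nu t * (1 - cabs (hfun nu w) ^+ 2).
  rewrite (hfun_cabs pn rw (ltW w1)).
  have -> : cabs (w - t) ^+ 2 / (1 - cabs w ^+ 2) * kfun nu t * ((1 - cabs w ^+ 2) * kfun nu w) =
    cabs (w - t) ^+ 2 * (kfun nu w * kfun nu t) by field; rewrite gt_eqF.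
  rewrite /n -(cabs_one_sub_conj _ (hfun_unit pn tC)) -(cabs_one_sub_conj _ t1).
  rewrite (hfun_kernel pn rw rt (ltW w1) t1') cabsM exprMn.
  by apply: ler_wpM2l; [exact: sqr_ge0|exact: Kfun_cauchy_schwarz].
have X01 : 0 <= cabs (hfun nu w) ^+ 2 <= 1 by rewrite sqr_ge0 expr_le1.
have J0 : 0 <= cabs (w - t) ^+ 2 / (1 - cabs w ^+ 2) by rewrite divr_ge0 ?sqr_ge0 // ltW.
apply: le_trans (julia_real (kfun_ge0 pn rt) J0 X01 r01 e0 hn).
have -> : cabs (r%:C%C * u * hfun nu w) ^+ 2 = r ^+ 2 * cabs (hfun nu w) ^+ 2.
  by rewrite -mulrA cabs_realM ?ltW // cabsM u1 mul1r exprMn.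
have den : 0 < 1 - r ^+ 2 * cabs (hfun nu w) ^+ 2.
  by case/andP: X01 => X0 X1; nra.
rewrite ler_wpM2r ?invr_ge0 ?(ltW den) // lerXn2r ?nnegrE ?cabs_ge0 //.
  by rewrite addr_ge0 ?cabs_ge0 // subr_ge0 ltW.
have -> : r%:C%C * u * hfun nu w - u * hfun nu t =
    u * ((hfun nu w - hfun nu t) - (1 - r)%:C%C * hfun nu w).
  by rewrite rmorphB rmorph1 /=; ring.
rewrite cabsM u1 mul1r; apply: le_trans (cabsB _ _) _.
rewrite lerD2l cabs_realM ?subr_ge0 ?(ltW r1) //.
by rewrite ler_piMr // subr_ge0 ltW.
Qed.

Lemma julia_fixed_point (mu1 mu2 : probability (R * R)%type R) (t1 t2 u : C) :
  prob_on_T mu1 -> prob_on_T mu2 -> fm_Cset mu1 t1 -> fm_Cset mu2 t2 -> cabs u = 1 ->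
  t2 = u * hfun mu1 t1 -> t1 = u * hfun mu2 t2 -> kfun mu1 t1 * kfun mu2 t2 < 1 ->
  exists2 K : R, 0 <= K & forall (r : R) (w1 w2 : C), 0 < r < 1 -> cabs w1 < 1 -> cabs w2 < 1 ->
    w2 = r%:C%C * u * hfun mu1 w1 -> w1 = r%:C%C * u * hfun mu2 w2 ->
    cabs (w1 - t1) ^+ 2 <= K * (1 - r).
Proof.
move=> p1 p2 C1 C2 u1 e12 e21 kk.
have k10 := kfun_ge0 p1 (regular_Cset C1); have k20 := kfun_ge0 p2 (regular_Cset C2).
move: kk k10 k20; set k1 := kfun _ _; set k2 := kfun _ _ => kk k10 k20.
pose e := (1 - k1 * k2) / 4.
have k0 : 0 <= k1 * k2 by rewrite mulr_ge0.
have e0 : 0 < e by rewrite /e; lra.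
have e1 : e <= 1 by rewrite /e; lra.
pose q := (1 + e) * k2 * ((1 + e) * k1).
have q1 : q <= 1 - e.
  have -> : q = (1 + e) ^+ 2 * (k1 * k2) by rewrite /q; ring.
  have -> : k1 * k2 = 1 - 4 * e by rewrite /e; lra.
  by nra.
have i0 : 0 < 1 + e^-1 by rewrite addr_gt0 ?invr_gt0.
pose c := (1 + e) * k2 * (1 + e^-1) + (1 + e^-1).
have e10 : 0 <= 1 + e by lra.
have c0 : 0 <= c.
  apply: addr_ge0; last exact: ltW.
  by apply: mulr_ge0; [exact: mulr_ge0|exact: ltW].
exists (c / e); first by rewrite divr_ge0 // ltW.
move=> r w1 w2 r01 w11 w21 f12 f21.
have h1 := julia_half p1 C1 w11 u1 r01 e0; rewrite -f12 -e12 in h1.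
have h2 := julia_half p2 C2 w21 u1 r01 e0; rewrite -f21 -e21 in h2.
move: h1 h2; rewrite -/k1 -/k2.
set J1 := cabs (w1 - t1) ^+ 2 / _; set J2 := cabs (w2 - t2) ^+ 2 / _ => h1 h2.
have w2' : 0 < 1 - cabs w1 ^+ 2 by rewrite subr_gt0 expr_lt1 ?cabs_ge0.
have J10 : 0 <= J1 by rewrite divr_ge0 ?sqr_ge0 // ltW.
have le1 : cabs (w1 - t1) ^+ 2 <= J1.
  by rewrite /J1 ler_pdivlMr // ler_piMr ?sqr_ge0 // lerBlDr lerDl sqr_ge0.
have J1q : J1 <= q * J1 + c * (1 - r).
  apply: le_trans h2 _.
  have : (1 + e) * k2 * J2 <= (1 + e) * k2 * ((1 + e) * k1 * J1 + (1 + e^-1) * (1 - r)).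
    by apply: ler_wpM2l => //; exact: mulr_ge0.
  rewrite /q /c; set A := (1 + e) * k2; set B := (1 + e) * k1; set D := 1 + e^-1 => hA.
  apply: (@le_trans _ _ (A * (B * J1 + D * (1 - r)) + D * (1 - r))); first by rewrite lerD2r.
  by rewrite le_eqVlt; apply/orP; left; apply/eqP; ring.
apply: le_trans le1 _; rewrite mulrAC ler_pdivlMr //.
have : q * J1 <= (1 - e) * J1 by apply: ler_wpM2r.
by lra.
Qed.

End Julia.

Section Backward.
Variable R : realType.
Local Notation C := R[i].
Local Notation cabs := (@fm_cabs R).
Variables (mu1 mu2 mu : probability (R * R)%type R) (w1 w2 : C -> C).
Hypotheses (p1 : prob_on_T mu1) (p2 : prob_on_T mu2) (p : prob_on_T mu).
Hypothesis sub : subordination mu1 mu2 mu w1 w2.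
Variables t1 t2 u : C.
Hypotheses (C1 : fm_Cset mu1 t1) (C2 : fm_Cset mu2 t2) (u1 : cabs u = 1).
Hypotheses (e12 : t2 = u * hfun mu1 t1) (e21 : t1 = u * hfun mu2 t2).
Hypothesis kk : kfun mu1 t1 * kfun mu2 t2 < 1.

(* Otherwise eta_mu vanishes along a piece of the radius, so mu has the moments of Haar measure;
   then 0 is a fixed point of the iteration, against [julia_fixed_point], or C_mu1 or C_mu2 is empty. *)
Lemma backward_nonvanishing : free_mult_conv mu1 mu2 mu -> forall e : R, 0 < e ->
  exists r : R, [/\ 1 - e < r, 0 < r < 1 & fm_eta mu (r%:C%C * u) != 0].
Proof.
move=> fr; have [//|m0] := eta_nonvanishing p u1; exfalso.
have [[m1 m2]|m1|m2] := free_conv_moments fr m0; last first.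
- exact: (moments_eq0_Cset p2 m2 C2).
- exact: (moments_eq0_Cset p1 m1 C1).
have h0 (nu : probability (R * R)%type R) : fm_cint nu (@fm_toC R) = 0 -> hfun nu 0 = 0.
  move=> m; rewrite /hfun (_ : brsv nu 0 = 0) ?mul0r // -[RHS]m.
  by congr fm_cint; apply/funext => s; rewrite /rsv mul0r subr0 invr1 mulr1.
have [K K0 hK] := julia_fixed_point p1 p2 C1 C2 u1 e12 e21 kk.
pose r := 1 - (2 * (K + 1))^-1.
have K2 : 0 < (2 * (K + 1))^-1 by rewrite invr_gt0; lra.
have K1 : (2 * (K + 1))^-1 <= 2^-1 by rewrite lef_pV2 ?posrE //; lra.
have := hK r 0 0; rewrite cabs0 ltr01 !h0 // mulr0 sub0r cabsN.
have [-> _] := C1; rewrite expr1n /r => H.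
have {}H := H _ isT isT erefl erefl.
have rr : 0 < 1 - (2 * (K + 1))^-1 < 1 by apply/andP; split; lra.
move/(_ rr): H; rewrite opprB addrCA subrr addr0 ler_pdivlMr; last by lra.
by lra.
Qed.

Lemma backward_value : (forall e : R, 0 < e ->
  exists r : R, [/\ 1 - e < r, 0 < r < 1 & fm_eta mu (r%:C%C * u) != 0]) -> w1 u = t1.
Proof.
move=> nv; have [K K0 hK] := julia_fixed_point p1 p2 C1 C2 u1 e12 e21 kk.
have u1' : cabs u <= 1 by rewrite u1.
apply/eqP; rewrite -subr_eq0 -cabs_eq0 eq_le cabs_ge0 andbT leNgt; apply/negP => c0.
pose e := cabs (w1 u - t1) / 2.
have e0 : 0 < e by rewrite divr_gt0.
have [d d0 hd] := subordination_cvg sub u1' e0.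
have K1 : 0 < K + 1 by lra.
pose d' := Num.min d (e ^+ 2 / (K + 1)).
have d'0 : 0 < d' by rewrite lt_min d0 divr_gt0 // exprn_gt0.
have d'd : d' <= d by rewrite ge_min lexx.
have d'e : d' * (K + 1) <= e ^+ 2 by rewrite -ler_pdivlMr // ge_min lexx orbT.
have [r [r1 r01 er]] := nv _ d'0; have /andP[r0 rl1] := r01.
have cz : cabs (r%:C%C * u) = r by rewrite cabs_realM ?(ltW r0) // u1 mulr1.
have z1 : cabs (r%:C%C * u) < 1 by rewrite cz.
have [f1 f2 l1 l2 _] := fixed_point p1 p2 p sub z1 er.
have h1 := hK r _ _ r01 (le_lt_trans l1 z1) (le_lt_trans l2 z1) f2 f1.
have h2 : cabs (w1 (r%:C%C * u) - w1 u) < e.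
  apply: hd; first by rewrite /fm_cdisk /= ltW.
  rewrite (_ : _ - u = - ((1 - r)%:C%C * u)); last by rewrite rmorphB rmorph1 /=; ring.
  by rewrite cabsN cabs_realM ?subr_ge0 ?(ltW rl1) // u1 mulr1; lra.
have h3 : cabs (w1 (r%:C%C * u) - t1) < e.
  rewrite -ltr_sqr ?nnegrE ?cabs_ge0 ?(ltW e0) //; apply: le_lt_trans h1 _.
  by nra.
have := cabs_dist_triangle (w1 u) (w1 (r%:C%C * u)) t1.
by rewrite [cabs (w1 u - w1 _)]cabs_distC /e in h2 h3 *; lra.
Qed.

Lemma backward_Cset : w1 u = t1 -> w2 u = t2 -> fm_Cset mu u.
Proof.
move=> wu1 wu2; have sub' := subordination_sym sub.
have u1' : cabs u <= 1 by rewrite u1.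
have [t11 _] := C1; have [t21 _] := C2.
have k10 := kfun_ge0 p1 (regular_Cset C1); have k20 := kfun_ge0 p2 (regular_Cset C2).
pose F := cnear (@odisk R) u; have FF : Filter F by exact: cnear_filter.
have c1 : ctends F w1 t1 by rewrite -wu1; exact: (subordination_cvg_odisk sub u1').
have c2 : ctends F w2 t2 by rewrite -wu2; exact: (subordination_cvg_odisk sub' u1').
have comp (f : C -> R) (w : C -> C) t : f z @[z --> cnear setT t] --> f t -> ctends F w t ->
    f (w z) @[z --> F] --> f t.
  move=> ft wt; apply/cvgrPdist_lt => e e0; have /cvgrPdist_lt/(_ e e0) [del del0 h] := ft.
  by apply: filterS (wt _ del0) => z zw; exact: h.
have ck1 := comp _ _ _ (kfun_cvg p1 (regular_Cset C1) t11) c1.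
have ck2 := comp _ _ _ (kfun_cvg p2 (regular_Cset C2) t21) c2.
have cn1 := comp _ _ _ (nrsv_cvg p1 (regular_Cset C1)) c1.
have ckk : kfun mu1 (w1 z) * kfun mu2 (w2 z) @[z --> F] --> kfun mu1 t1 * kfun mu2 t2.
  by apply: cvgM.
pose q := (1 + kfun mu1 t1 * kfun mu2 t2) / 2.
have kq : kfun mu1 t1 * kfun mu2 t2 < q by rewrite /q; move: kk; set kap := _ * _; lra.
have q1 : q < 1 by rewrite /q; move: kk; set kap := _ * _; lra.
have nkk := cvgr_lt _ ckk _ kq.
have near_all : \forall z \near F, [/\ w1 z != 0, w2 z != 0, z != 0,
    kfun mu1 (w1 z) * kfun mu2 (w2 z) < q &
    kfun mu2 (w2 z) < kfun mu2 t2 + 1 /\ nrsv mu1 (w1 z) < nrsv mu1 t1 + 1].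
  near=> z; split.
  - by near: z; exact: ctends_neq0 (cabs1_neq0 t11) c1.
  - by near: z; exact: ctends_neq0 (cabs1_neq0 t21) c2.
  - by near: z; exact: ctends_neq0 (cabs1_neq0 u1) (@ctends_id _ (@odisk R) u).
  - by near: z; exact: nkk.
  - split; near: z.
    + by apply: (cvgr_lt _ ck2); rewrite ltrDl.
    + by apply: (cvgr_lt _ cn1); rewrite ltrDl.
have [d d0 hd] := near_all.
have r1 := regular_Cset C1.
have N0 : 0 <= nrsv mu1 t1 + 1.
  by rewrite addr_ge0 // (le_trans (sqr_ge0 _) (nrsv_ge p1 r1)).
have q1' : 0 < 1 - q by rewrite subr_gt0.
pose K := (2 + kfun mu2 t2) / (1 - q).
have K0 : 0 <= K by rewrite divr_ge0 ?(ltW q1') // addr_ge0.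
have bound z : cabs z < 1 -> cabs (z - u) < d -> nrsv mu z <= K * (nrsv mu1 t1 + 1).
  move=> z1 zu; have [n1 n2 n3 h1 [h2 h3]] := hd z z1 zu.
  have ez : fm_eta mu z != 0.
    by have [_ _ ->] := sub.2 z z1; rewrite mulf_neq0 ?invr_eq0 // mulf_neq0.
  have [_ _ l1 l2 _] := fixed_point p1 p2 p sub z1 ez.
  have d1 := defect_subordination p1 p2 p sub z1 ez.
  have d2 := defect_subordination p2 p1 p sub' z1 ez.
  have nn := nrsv_subordination p1 p2 p sub z1 ez.
  have rw1 := regular_disk p1 (le_lt_trans l1 z1); have rw2 := regular_disk p2 (le_lt_trans l2 z1).
  have k1 := kfun_ge0 p1 rw1; have k2 := kfun_ge0 p2 rw2.
  have nw := le_trans (sqr_ge0 _) (nrsv_ge p1 rw1).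
  have w10 : 0 <= 1 - cabs (w1 z) ^+ 2.
    by rewrite subr_ge0 expr_le1 ?cabs_ge0 // ltW // (le_lt_trans l1).
  have w20 : 0 <= 1 - cabs (w2 z) ^+ 2.
    by rewrite subr_ge0 expr_le1 ?cabs_ge0 // ltW // (le_lt_trans l2).
  have zz : 0 < 1 - cabs z ^+ 2 by rewrite subr_gt0 expr_lt1 ?cabs_ge0.
  have Z1 : cabs z ^+ 2 <= 1 by lra.
  have Z0 := sqr_ge0 (cabs z).
  move: d1 d2 nn k1 k2 nw w10 w20 zz Z1 Z0 h1 h2 h3.
  set U1 := 1 - cabs (w1 z) ^+ 2; set U2 := 1 - cabs (w2 z) ^+ 2; set D := 1 - cabs z ^+ 2.
  set k1 := kfun mu1 (w1 z); set k2 := kfun mu2 (w2 z); set Z := cabs z ^+ 2.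
  move=> d1 d2 nn k10' k20' nw w10 w20 zz Z1 Z0 h1 h2 h3.
  have b2 : U2 <= D + U1 * k1.
    by rewrite d1 lerD2l ler_piMl // mulr_ge0.
  have b1 : U1 <= D + (D + U1 * k1) * k2.
    apply: (@le_trans _ _ (D + U2 * k2)); first by rewrite {1}d2 lerD2l ler_piMl // mulr_ge0.
    by rewrite lerD2l ler_wpM2r.
  have b3 : U1 * (k1 * k2) <= U1 * q by apply: ler_wpM2l => //; exact: ltW.
  have b4 : D * k2 <= D * (kfun mu2 t2 + 1) by apply: ler_wpM2l; exact: ltW.
  have b5 : U1 * (1 - q) <= D * (2 + kfun mu2 t2).
    by move: b1; rewrite mulrDl -mulrA => b1; lra.
  have b6 : U1 <= D * K by rewrite /K mulrA ler_pdivlMr.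
  rewrite -(ler_pM2l zz) -nn mulrA; apply: ler_pM => //; exact: ltW.
apply: (Cset_of_bound p u1 d0 (Q := K * (nrsv mu1 t1 + 1))); first exact: mulr_ge0.
move=> w ww wd e e0; have ww' : cabs w <= 1 by rewrite ww.
have e'0 : 0 < Num.min e (d - cabs (w - u)) by rewrite lt_min e0 subr_gt0.
have [z z1] := odisk_approx ww' e'0; rewrite lt_min => /andP[ze zd].
exists z; split=> //; apply: bound => //.
by apply: le_lt_trans (cabs_dist_triangle z w u) _; lra.
Unshelve. all: by end_near. Qed.

End Backward.

Section InverseContinuity.
Variable R : realType.
Local Notation C := R[i].
Local Notation cabs := (@fm_cabs R).

Definition cnear2 (S : set (C * C)) (q : C * C) : set_system (C * C) :=
  [set P | exists2 d : R, 0 < d &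
    forall x, S x -> cabs (x.1 - q.1) < d -> cabs (x.2 - q.2) < d -> P x].

Global Instance cnear2_filter S q : Filter (cnear2 S q).
Proof.
split.
- by exists 1.
- move=> P Q [d d0 Pd] [e e0 Qe]; exists (Num.min d e); first by rewrite lt_min d0.
  move=> x Sx; rewrite !lt_min => /andP[a b] /andP[c f].
  by split; [exact: Pd|exact: Qe].
- by move=> P Q PQ [d d0 Pd]; exists d => // x Sx a b; exact/PQ/Pd.
Qed.

Lemma inverse_continuous (mu1 mu2 : probability (R * R)%type R) q : prob_on_T mu1 ->
  fm_Dset mu1 mu2 q ->
  fm_cont2_within (fm_Dset mu1 mu2) (fun x : C * C => x.1 * x.2 / fm_eta mu1 x.1) q.
Proof.
move=> p1 [C1 _]; have [t1 _] := C1; have r1 := regular_Cset C1.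
pose F := cnear2 (fm_Dset mu1 mu2) q.
have c1 : ctends F fst q.1 by move=> e e0; exists e.
have c2 : ctends F snd q.2 by move=> e e0; exists e.
have a0 : mrsv mu1 q.1 != 0 by apply: mrsv_neq0; rewrite ?t1.
have ce : ctends F (fun x => fm_eta mu1 x.1) (fm_eta mu1 q.1).
  have h : ctends F (fun x => 1 - (mrsv mu1 x.1)^-1) (1 - (mrsv mu1 q.1)^-1).
    apply: ctendsB; first exact: ctends_cst.
    apply: ctendsV => //; apply: (@ctends_comp _ _ _ _ setT fst (mrsv mu1)) => //.
      exact: filterE.
    exact: mrsv_cvg.
  rewrite eta_mrsv ?t1 // => e e0; have [d d0 hd] := h e e0.
  exists d => // x xD x1 x2; have [Cx _] := xD; have [tx _] := Cx.
  by rewrite eta_mrsv ?tx //; [exact: hd|exact: regular_Cset].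
have n0 : fm_eta mu1 q.1 != 0 by rewrite -cabs_gt0 eta_unit.
have h : ctends F (fun x => x.1 * x.2 / fm_eta mu1 x.1) (q.1 * q.2 / fm_eta mu1 q.1).
  by apply: ctendsM; [exact: ctendsM|exact: ctendsV].
by move=> e e0; have [d d0 hd] := h e e0; exists d.
Qed.

End InverseContinuity.

Theorem theorem6p3 (R : realType) (mu1 mu2 mu : probability (R * R)%type R)
    (w1 w2 : R[i] -> R[i]) :
  prob_on_T mu1 -> prob_on_T mu2 -> prob_on_T mu ->
  ~ is_point_mass mu1 -> ~ is_point_mass mu2 ->
  free_mult_conv mu1 mu2 mu ->
  subordination mu1 mu2 mu w1 w2 ->
  let G := fun q : R[i] * R[i] => q.1 * q.2 / fm_eta mu1 q.1 in
  [/\ (forall t, fm_Cset mu t -> fm_Dset mu1 mu2 (w1 t, w2 t)),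
      (forall t, fm_Cset mu t -> G (w1 t, w2 t) = t),
      (forall q, fm_Dset mu1 mu2 q -> fm_Cset mu (G q) /\ (w1 (G q), w2 (G q)) = q),
      (forall q, fm_Dset mu1 mu2 q -> q.1 * q.2 / fm_eta mu1 q.1 = q.1 * q.2 / fm_eta mu2 q.2) &
      [/\ (forall t, fm_Cset mu t -> fm_cont_within (fm_Cset mu) w1 t),
          (forall t, fm_Cset mu t -> fm_cont_within (fm_Cset mu) w2 t) &
          (forall q, fm_Dset mu1 mu2 q -> fm_cont2_within (fm_Dset mu1 mu2) G q)]].

Proof.
move=> p1 p2 p _ _ fr sub G; have sub' := subordination_sym sub.
have back q : fm_Dset mu1 mu2 q -> [/\ fm_Cset mu (G q), w1 (G q) = q.1 & w2 (G q) = q.2].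
  move=> qD; have [u1 e12 e21] := Dset_fixed_point p1 p2 qD.
  have kk := Dset_kfun p1 p2 qD; case: (qD) => C1 [C2 _].
  have nv := backward_nonvanishing p1 p2 p C1 C2 u1 e12 e21 kk fr.
  have v1 := backward_value p1 p2 p sub C1 C2 u1 e12 e21 kk nv.
  have kk' : kfun mu2 q.2 * kfun mu1 q.1 < 1 by rewrite mulrC.
  have v2 := backward_value p2 p1 p sub' C2 C1 u1 e21 e12 kk' nv.
  by split=> //; exact: (backward_Cset p1 p2 p sub C1 C2 u1 kk v1 v2).
have cw w : w = w1 \/ w = w2 -> forall t, fm_Cset mu t -> fm_cont_within (fm_Cset mu) w t.
  move=> ww t [t1 _] e e0; have [_ ct _ _] := sub.1 w ww.
  have t1' : fm_cabs t <= 1 by rewrite t1.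
  have [d d0 h] := ct t t1' e e0; exists d => // z [z1 _].
  by apply: h; rewrite /fm_cdisk /= z1.
split.
- by move=> t tC; have [] := forward_Dset p1 p2 p sub tC.
- by move=> t tC; have [] := forward_Dset p1 p2 p sub tC.
- by move=> q /back[qC q1 q2]; split=> //; rewrite q1 q2; case: q {qC q1 q2}.
- by move=> q /Dset_eta ->.
split.
- exact: (cw w1 (or_introl erefl)).
- exact: (cw w2 (or_intror erefl)).
- by move=> q qD; exact: inverse_continuous.
Qed.
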